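(* Let $A$, $W$, $F$, $G$, $x_0$ satisfy the standing assumptions listed in the context, let $h\in(0,1]$ and $\Delta t\in(0,1]$ with $N_{\Delta t}=T/\Delta t\in\mathbb{N}$, and let $(X_{h,\Delta t}^{t_j})_{j=0}^{N_{\Delta t}}$ be the fully discrete drift-implicit Euler approximation, i.e. $X_{h,\Delta t}^{t_0}=P_hx_0$ and $$X_{h,\Delta t}^{t_{j+1}}-X_{h,\Delta t}^{t_j}=\big(A_hX_{h,\Delta t}^{t_{j+1}}+P_hF(t_j,X_{h,\Delta t}^{t_j})\big)\Delta t+P_hG(t_j)\Delta W^j,\qquad j=0,\dots,N_{\Delta t}-1.$$ Then the mean $\mu^T=\mathbb{E}[X_{h,\Delta t}^T]\in V_h$ and the covariance $\Sigma^T=\mathsf{Cov}(X_{h,\Delta t}^T)\in V_h^{\otimes 2}$ are given by the recursions $$R_{h,\Delta t}\,\mu^{t_{j+1}}=F^{1,j}_{h,\Delta t}\,\mu^{t_j}+F^{2,j}_{h,\Delta t},$$ $$(R_{h,\Delta t})^{\otimes 2}\,\Sigma^{t_{j+1}}=(F^{1,j}_{h,\Delta t})^{\otimes 2}\,\Sigma^{t_j}+\mathbb{E}\big[(P_hG(t_j)\Delta W^j)^{\otimes 2}\big],$$ for $j=0,1,\dots,N_{\Delta t}-1$, started at $\mu^{t_0}=\mathbb{E}[X_{h,\Delta t}^{t_0}]$ and $\Sigma^{t_0}=\mathsf{Cov}(X_{h,\Delta t}^{t_0})$.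
   Context: **Spaces and operators.** $(H,\langle\cdot,\cdot\rangle,\|\cdot\|)$ is a real separable Hilbert space and $-A:\mathrm{dom}(-A)\subset H\to H$ is positive definite and self-adjoint with compact inverse, with orthonormal eigenbasis $(e_i)$ of $H$ and increasing eigenvalues $\lambda_i>0$, $\lambda_i\to\infty$. For $r\in\mathbb{R}$, $(-A)^{r/2}f=\sum_i\lambda_i^{r/2}\langle f,e_i\rangle e_i$, and $\dot H^r=\mathrm{dom}((-A)^{r/2})$ is the Hilbert space with inner product $\langle f,g\rangle_r=\langle(-A)^{r/2}f,(-A)^{r/2}g\rangle$ and norm $\|\cdot\|_r$; $\dot H^{-r}$ is identified with the dual of $\dot H^r$ for $r>0$. $\mathcal{L}(\cdot,\cdot)$ and $\mathcal{L}_2(\cdot,\cdot)$ denote bounded linear and Hilbert–Schmidt operators. **Equation.** $T<\infty$ is fixed and $(\Omega,\mathcal{A},(\mathcal{F}_t)_{t\in[0,T]},P)$ is a complete filtered probability space satisfying the usual conditions. The SPDE is $dX(t)=(AX(t)+F(t,X(t)))\,dt+G(t)\,dW(t)$, $X(0)=x_0$. **Standing assumptions.** (i) $W$ is an $(\mathcal{F}_t)$-adapted cylindrical $Q$-Wiener process, with $Q\in\mathcal{L}(H)$ self-adjoint and positive semidefinite, not necessarily of trace class. Let $\mathcal{L}_2^0=\mathcal{L}_2(Q^{1/2}(H),H)$, where $Q^{1/2}(H)$ carries the inner product $\langle Q^{-1/2}\cdot,Q^{-1/2}\cdot\rangle$ ($Q^{-1/2}$ the pseudoinverse of $Q^{1/2}$).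 (ii) $G:[0,T]\to\mathcal{L}_2^0$ and there is $C>0$ with $\|G(t_1)-G(t_2)\|_{\mathcal{L}_2^0}\le C|t_1-t_2|^{1/2}$ for all $t_1,t_2\in[0,T]$. (iii) $F:[0,T]\times H\to\dot H^{-1}$ is affine in the second argument: $F(t,f)=F^1_tf+F^2_t$ with $F^1_t\in\mathcal{L}(H,\dot H^{-1})$, $F^2_t\in\dot H^{-1}$; and there is $C>0$ with $\|F(t_1,f)-F(t_2,f)\|_{-1}\le C(1+\|f\|)|t_1-t_2|^{1/2}$ for all $f\in H$, $t_1,t_2\in[0,T]$, and $\|F^1_t\|_{\mathcal{L}(H,\dot H^{-1})}\le C$ for all $t\in[0,T]$. (iv) $x_0$ is a (possibly degenerate, i.e. with covariance only positive semidefinite) $\mathcal{F}_0$-measurable $\dot H^1$-valued Gaussian random variable. **Discretization.** $(V_h)_{h\in(0,1]}$ is a family of finite-dimensional subspaces of $\dot H^1$, equipped with $\langle\cdot,\cdot\rangle$. $P_h:\dot H^{-1}\to V_h$ is the generalized orthogonal projector, $\langle P_hf,\Phi_h\rangle={}_{\dot H^{-1}}\langle f,\Phi_h\rangle_{\dot H^1}$ for all $\Phi_h\in V_h$ (dual pairing on the right), and $R_h:\dot H^1\to V_h$ is the orthogonal projector with respect to $\langle\cdot,\cdot\rangle_1$. It is assumed that there is $C>0$ such that, for all $h\in(0,1]$, $\|P_hf\|_1\le C\|f\|_1$ for $f\in\dot H^1$ and $\|R_hf-f\|\le C\|f\|_sh^s$ for $f\in\dot H^s$, $s\in\{1,2\}$.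 The operator $-A_h:V_h\to V_h$ is defined by $\langle-A_hf_h,g_h\rangle=\langle f_h,g_h\rangle_1$ for $f_h,g_h\in V_h$. The time grid is $t_j=j\Delta t$, $j=0,\dots,N_{\Delta t}=T/\Delta t\in\mathbb{N}$, and $\Delta W^j=W(t_{j+1})-W(t_j)$; $P_hG(t_j)\Delta W^j$ is understood as the $V_h$-valued Itô integral $\int_{t_j}^{t_{j+1}}P_hG(t_j)\,dW(s)$. **Abbreviations.** $R_{h,\Delta t}=I-\Delta t\,A_h$, $F^{1,j}_{h,\Delta t}=I+\Delta t\,P_hF^1_{t_j}$, $F^{2,j}_{h,\Delta t}=\Delta t\,P_hF^2_{t_j}$, with $I$ the identity. **Tensors and covariance.** $H_1\otimes H_2$ is the Hilbert tensor product, $V^{\otimes2}=V\otimes V$, $f^{\otimes2}=f\otimes f$; for linear operators, $(S\otimes S')(u\otimes v)=Su\otimes S'v$ and $S^{\otimes2}=S\otimes S$. $\mathsf{Cov}(X)=\mathbb{E}[(X-\mathbb{E}[X])^{\otimes2}]$. *)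

(* Defs.v *)
From HB Require Import structures.
From mathcomp Require Import all_boot all_order all_algebra.
From mathcomp Require Import all_classical all_reals all_analysis.

Set Implicit Arguments.
Unset Strict Implicit.
Unset Printing Implicit Defensive.

Import Order.TTheory GRing.Theory Num.Theory.
Import numFieldNormedType.Exports.

Local Open Scope classical_set_scope.
Local Open Scope ring_scope.

HB.mixin Record CompleteNormedModule_isHilbert (R : realType) H
    of CompleteNormedModule R H := {
  dot : H -> H -> R;
  dotC : forall x y, dot x y = dot y x;
  dot_linearl : forall a x y z, dot (a *: x + y) z = a * dot x z + dot y z;
  dot_norm : forall x, dot x x = `|x| ^+ 2
}.

#[short(type="hilbertType")]
HB.structure Definition Hilbert (R : realType) :=
  {H of CompleteNormedModule_isHilbert R H & CompleteNormedModule R H}.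

Definition separable_space (T : topologicalType) : Prop :=
  exists D : set T, countable D /\ dense D.

Section linear_notions.
Context {R : realType}.

Definition span {V : lmodType R} (S : set V) : set V :=
  [set x | exists n (c : 'I_n -> R) (s : 'I_n -> V),
     (forall i, S (s i)) /\ x = \sum_(i < n) c i *: s i].

Definition is_subspace {V : lmodType R} (D : set V) : Prop :=
  D 0 /\ forall (a : R) x y, D x -> D y -> D (a *: x + y).

Definition fin_dim_subspace {V : lmodType R} (D : set V) : Prop :=
  exists n (b : 'I_n -> V),
    D = [set x | exists c : 'I_n -> R, x = \sum_(i < n) c i *: b i].

(* An operator defined on a subspace D is represented by a total function whose
   values outside D are irrelevant. *)
Definition linear_on {V W : lmodType R} (D : set V) (B : V -> W) : Prop :=
  forall (a : R) x y, D x -> D y -> B (a *: x + y) = a *: B x + B y.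

(* orthonormal basis of the Hilbert space (D, ip): density of the span is meant
   in the norm of (D, ip) *)
Definition orthonormal_basis {V : lmodType R} (D : set V) (ip : V -> V -> R)
    (E : set V) : Prop :=
  [/\ E `<=` D,
      forall x, E x -> ip x x = 1,
      forall x y, E x -> E y -> x <> y -> ip x y = 0
    & forall x (eps : R), D x -> 0 < eps ->
        exists2 y, span E y & ip (x - y) (x - y) < eps].

(* Hilbert-Schmidt norm of an operator on (D, ip), computed in some orthonormal
   basis of (D, ip), on the choice of which it does not depend *)
Definition hs_norm {H K : hilbertType R} (D : set H) (ip : H -> H -> R)
    (B : H -> K) : \bar R :=
  sqrte (\esum_(x in xget set0 [set E | orthonormal_basis D ip E])
           (`|B x| ^+ 2)%:E)%E.

Definition hilbert_schmidt {H K : hilbertType R} (D : set H)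
    (ip : H -> H -> R) (B : H -> K) : Prop :=
  [/\ linear_on D B,
      exists C : R, forall x, D x -> `|B x| <= C * Num.sqrt (ip x x)
    & (hs_norm D ip B < +oo)%E].

End linear_notions.

Section tensor.
Context {R : realType}.

Record hilbert_tensor {H1 H2 K : hilbertType R} (tens : H1 -> H2 -> K) : Prop := {
  tens_linl : forall (a : R) x y z,
    tens (a *: x + y) z = a *: tens x z + tens y z;
  tens_linr : forall (a : R) x y z,
    tens z (a *: x + y) = a *: tens z x + tens z y;
  tens_dot : forall x y x' y', dot (tens x y) (tens x' y') = dot x x' * dot y y';
  tens_dense : dense (span [set tens x y | x in [set: H1] & y in [set: H2]])
}.

Context {H K : hilbertType R} (tens : H -> H -> K).

(* V (x) V inside H (x) H; for finite-dimensional V no closure is needed *)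
Definition tens_subspace (V : set H) : set K :=
  span [set tens x y | x in V & y in V].

(* S (x) S' on V (x) V, for linear S, S' on a finite-dimensional V *)
Definition tens_op (V : set H) (S S' : H -> H) (k : K) : K :=
  xget 0 [set k' | exists n (u v : 'I_n -> H),
    [/\ forall i, V (u i) /\ V (v i),
        k = \sum_(i < n) tens (u i) (v i)
      & k' = \sum_(i < n) tens (S (u i)) (S' (v i))]].

End tensor.

Section operators.
Context {R : realType} {H : hilbertType R}.

Record generator (domA : set H) (A : H -> H) (e : nat -> H) (lam : nat -> R)
    : Prop := {
  gen_subspace : is_subspace domA;
  gen_linear : linear_on domA A;
  gen_dense : dense domA;
  (* A coincides with its adjoint, domains included *)
  gen_selfadjoint : forall f g,
    (domA f /\ A f = g) <-> (forall x, domA x -> dot (A x) f = dot x g);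
  gen_posdef : forall f, domA f -> f != 0 -> 0 < dot (- A f) f;
  gen_compact_inverse : exists K : H -> H,
    [/\ forall f, domA f -> K (- A f) = f,
        forall g, domA (K g) /\ - A (K g) = g
      & compact (closure [set K g | g in [set g | `|g| <= 1]])];
  gen_orthonormal : forall i j, dot (e i) (e j) = (i == j)%:R;
  gen_total : dense (span (range e));
  gen_eigen : forall i, domA (e i) /\ - A (e i) = lam i *: e i;
  gen_lam_gt0 : forall i, 0 < lam i;
  gen_lam_incr : forall i j, (i <= j)%N -> lam i <= lam j;
  gen_lam_cvg : lam i @[i --> \oo] --> +oo
}.

Section powers.
Context (e : nat -> H) (lam : nat -> R).

Definition pow_series (r : R) (f : H) : nat -> H :=
  series (fun i => (lam i `^ (r / 2) * dot f (e i)) *: e i).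

(* (-A)^(r/2) for r >= 0, with domain Hdot r; negative orders go through duality *)
Definition powA (r : R) (f : H) : H := lim (pow_series r f @ \oo).

Definition Hdot (r : R) : set H := [set f | cvg (pow_series r f @ \oo)].

Definition dot_ (r : R) (f g : H) : R := dot (powA r f) (powA r g).

Definition norm_ (r : R) (f : H) : R := `|powA r f|.

(* The space of order -1 is the dual of Hdot 1; a functional on Hdot 1 is
   represented by a function on H whose values outside Hdot 1 are irrelevant,
   and f in H is identified with the functional dot f. *)
Definition Hdotm1 : set (H -> R) :=
  [set l | (forall (a : R) x y, Hdot 1 x -> Hdot 1 y ->
              l (a *: x + y) = a * l x + l y) /\
           exists C : R, forall x, Hdot 1 x -> `|l x| <= C * norm_ 1 x].

Definition norm_m1 (l : H -> R) : R :=
  sup [set `|l x| | x in [set x | Hdot 1 x /\ norm_ 1 x <= 1]].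

Definition open_Hdot1 (U : set H) : Prop :=
  U `<=` Hdot 1 /\
  forall x, U x -> exists2 eps : R, 0 < eps &
    forall y, Hdot 1 y -> norm_ 1 (y - x) < eps -> U y.

(* the generalized orthogonal projector P_h onto V_h = V *)
Definition Pproj (V : set H) (l : H -> R) : H :=
  xget 0 [set v | V v /\ forall phi, V phi -> dot v phi = l phi].

(* the orthogonal projector R_h onto V_h = V in Hdot 1 *)
Definition Rproj (V : set H) (f : H) : H :=
  xget 0 [set v | V v /\ forall phi, V phi -> dot_ 1 v phi = dot_ 1 f phi].

Definition neg_Ah (V : set H) (f : H) : H :=
  xget 0 [set v | V v /\ forall g, V g -> dot v g = dot_ 1 f g].

Definition Ah (V : set H) (f : H) : H := - neg_Ah V f.

Record discretization (V : R -> set H) : Prop := {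
  disc_fin_dim : forall h : R, 0 < h <= 1 -> fin_dim_subspace (V h);
  disc_sub : forall h : R, 0 < h <= 1 -> V h `<=` Hdot 1;
  disc_bound : exists2 C : R, 0 < C & forall h : R, 0 < h <= 1 ->
    (forall f, Hdot 1 f -> norm_ 1 (Pproj (V h) (dot f)) <= C * norm_ 1 f) /\
    (forall (s : nat) f, s \in [:: 1%N; 2%N] -> Hdot s%:R f ->
       `|Rproj (V h) f - f| <= C * norm_ s%:R f * h ^+ s)
}.

Record drift (T : R) (F F1 : R -> H -> H -> R) (F2 : R -> H -> R) : Prop := {
  drift_affine : forall (t : R) f x, 0 <= t <= T -> Hdot 1 x ->
    F t f x = F1 t f x + F2 t x;
  drift_F1 : forall (t : R) f, 0 <= t <= T -> Hdotm1 (F1 t f);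
  drift_F1_linear : forall (t a : R) f g x, 0 <= t <= T -> Hdot 1 x ->
    F1 t (a *: f + g) x = a * F1 t f x + F1 t g x;
  drift_F2 : forall t : R, 0 <= t <= T -> Hdotm1 (F2 t);
  drift_holder : exists2 C : R, 0 < C &
    forall (t1 t2 : R) f, 0 <= t1 <= T -> 0 <= t2 <= T ->
      norm_m1 (fun x => F t1 f x - F t2 f x)
        <= C * (1 + `|f|) * Num.sqrt `|t1 - t2|;
  drift_bound : exists2 C : R, 0 < C &
    forall (t : R) f, 0 <= t <= T -> norm_m1 (F1 t f) <= C * `|f|
}.

End powers.

Definition bounded_psd (Q : H -> H) : Prop :=
  [/\ linear_on setT Q,
      exists C : R, forall x, `|Q x| <= C * `|x|,
      forall x y, dot (Q x) y = dot x (Q y)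
    & forall x, 0 <= dot (Q x) x].

Definition sqrt_op (Q : H -> H) : H -> H :=
  xget (fun=> 0) [set S | bounded_psd S /\ forall x, S (S x) = Q x].

Definition pinv_op (S : H -> H) (x : H) : H :=
  xget 0 [set y | S y = x /\ forall z, S z = 0 -> dot y z = 0].

Definition U0 (Q : H -> H) : set H := range (sqrt_op Q).

Definition dotU0 (Q : H -> H) (x y : H) : R :=
  dot (pinv_op (sqrt_op Q) x) (pinv_op (sqrt_op Q) y).

Definition L20 (Q : H -> H) (B : H -> H) : Prop :=
  hilbert_schmidt (U0 Q) (dotU0 Q) B.

Definition norm_L20 (Q : H -> H) (B : H -> H) : \bar R :=
  hs_norm (U0 Q) (dotU0 Q) B.

Record diffusion (T : R) (Q : H -> H) (G : R -> H -> H) : Prop := {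
  diff_L20 : forall t : R, 0 <= t <= T -> L20 Q (G t);
  diff_holder : exists2 C : R, 0 < C &
    forall t1 t2 : R, 0 <= t1 <= T -> 0 <= t2 <= T ->
      (norm_L20 Q (fun x => (G t1 x - G t2 x)%R)
         <= (C * Num.sqrt `|t1 - t2|)%:E)%E
}.

End operators.

Section probability.
Context {R : realType} {d : measure_display} {Om : measurableType d}.
Context (P : probability Om R).

Record usual_filtration (T : R) (Ft : R -> set (set Om)) : Prop := {
  filt_sigma : forall t : R, 0 <= t <= T ->
    sigma_algebra setT (Ft t) /\ Ft t `<=` measurable;
  filt_incr : forall s t : R, 0 <= s -> s <= t -> t <= T -> Ft s `<=` Ft t;
  (* all subsets of null sets; this includes completeness of P *)
  filt_complete : P.-negligible `<=` Ft 0;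
  filt_rcont : forall t : R, 0 <= t < T ->
    \bigcap_(s in [set s | t < s <= T]) Ft s `<=` Ft t
}.

(* Normal law with mean m and variance v >= 0; the library's normal_prob m s
   is not the Dirac mass for s = 0. *)
Definition normal_law (m v : R) (B : set R) : \bar R :=
  if v == 0 then dirac m B else normal_prob m (Num.sqrt v) B.

Definition has_normal_law (Y : Om -> R) (m v : R) : Prop :=
  measurable_fun setT Y /\
  forall B : set R, measurable B -> P (Y @^-1` B) = normal_law m v B.

Definition gaussian (Y : Om -> R) : Prop :=
  exists m v : R, 0 <= v /\ has_normal_law Y m v.

Definition sub_measurable (F0 : set (set Om)) (Y : Om -> R) : Prop :=
  forall B : set R, measurable B -> F0 (Y @^-1` B).

Definition indep_of (F0 : set (set Om)) (Y : Om -> R) : Prop :=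
  forall (B : set R) (D : set Om), measurable B -> F0 D ->
    P (Y @^-1` B `&` D) = (P (Y @^-1` B) * P D)%E.

Context {H : hilbertType R}.

Definition rand_var (X : Om -> H) : Prop :=
  forall U : set H, open U -> measurable (X @^-1` U).

(* (weak) expectation; it is the Bochner integral as soon as Z is Bochner
   integrable *)
Definition expect (Z : Om -> H) : H :=
  xget 0 [set m | forall phi,
    (dot m phi)%:E = ('E_P[fun w => dot (Z w) phi])%E].

Definition sq_integrable (Z : Om -> H) : Prop :=
  rand_var Z /\ ('E_P[fun w => (`|Z w| ^+ 2)%R] < +oo)%E.

Definition gaussian_Hdot1 (e : nat -> H) (lam : nat -> R) (F0 : set (set Om))
    (x0 : Om -> H) : Prop :=
  [/\ forall w, Hdot e lam 1 (x0 w),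
      forall U, open_Hdot1 e lam U -> F0 (x0 @^-1` U)
    & forall l, Hdotm1 e lam l -> gaussian (fun w => l (x0 w))].

(* Cylindrical Q-Wiener process: W t u w stands for (W(t), u) at w. *)
Record cylindrical_wiener (T : R) (Ft : R -> set (set Om)) (Q : H -> H)
    (W : R -> H -> Om -> R) : Prop := {
  cw_adapted : forall (t : R) u, 0 <= t <= T -> sub_measurable (Ft t) (W t u);
  cw_linear : forall (t a : R) u v, 0 <= t <= T ->
    {ae P, forall w, W t (a *: u + v) w = a * W t u w + W t v w};
  cw_zero : forall u, {ae P, forall w, W 0 u w = 0};
  cw_indep : forall (s t : R) u, 0 <= s -> s <= t -> t <= T ->
    indep_of (Ft s) (fun w => W t u w - W s u w);
  cw_normal : forall (s t : R) u, 0 <= s -> s <= t -> t <= T ->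
    has_normal_law (fun w => W t u w - W s u w) 0 ((t - s) * dot (Q u) u);
  cw_continuous : forall u,
    {ae P, forall w, {within `[0, T], continuous (fun t : R => W t u w)}}
}.

(* Y is the V-valued Ito integral over [s, t] of the deterministic and constant
   integrand B in L_2(Q^(1/2)(H), V): the L^2(Om; V)-limit of the integrals
   \sum_i (W(t) - W(s), u_i) v_i of finite rank operators \sum_i <., u_i> v_i
   converging to B in Hilbert-Schmidt norm. *)
Definition ito_integral (W : R -> H -> Om -> R) (Q : H -> H) (V : set H)
    (s t : R) (B : H -> H) (Y : Om -> H) : Prop :=
  [/\ rand_var Y, forall w, V (Y w)
    & exists (n : nat -> nat) (u v : nat -> nat -> H),
      [/\ forall k i, V (v k i),
          norm_L20 Q (fun x => B x - \sum_(i < n k) dot x (u k i) *: v k i)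
            @[k --> \oo] --> 0%E
        & ('E_P[fun w => (`|Y w -
              \sum_(i < n k) (W t (u k i) w - W s (u k i) w) *: v k i| ^+ 2)%R])%E
            @[k --> \oo] --> 0%E]].

End probability.

Section covariance.
Context {R : realType} {d : measure_display} {Om : measurableType d}.
Context {H K : hilbertType R}.
Context (P : probability Om R) (tens : H -> H -> K).

Definition second_moment (X : Om -> H) : K :=
  expect P (fun w => tens (X w) (X w)).

Definition Cov (X : Om -> H) : K :=
  second_moment (fun w => X w - expect P X).

End covariance.

Section scheme.
Context {R : realType} {H : hilbertType R} (e : nat -> H) (lam : nat -> R).
Context (V : set H) (dt : R).

Definition Rop (f : H) : H := f - dt *: Ah e lam V f.

Definition F1op (F1 : R -> H -> H -> R) (j : nat) (f : H) : H :=
  f + dt *: Pproj V (F1 (j%:R * dt) f).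

Definition F2op (F2 : R -> H -> R) (j : nat) : H :=
  dt *: Pproj V (F2 (j%:R * dt)).

Context {d : measure_display} {Om : measurableType d}.
Context (P : probability Om R).

(* dWG j is the noise increment P_h G(t_j) \Delta W^j *)
Record euler_scheme (N : nat) (Q : H -> H) (W : R -> H -> Om -> R)
    (F : R -> H -> H -> R) (G : R -> H -> H) (x0 : Om -> H)
    (dWG X : nat -> Om -> H) : Prop := {
  euler_noise : forall j, (j < N)%N ->
    ito_integral P W Q V (j%:R * dt) (j.+1%:R * dt)
      (fun x => Pproj V (dot (G (j%:R * dt) x))) (dWG j);
  euler_rv : forall j, (j <= N)%N -> rand_var (X j) /\ forall w, V (X j w);
  euler_init : {ae P, forall w, X 0%N w = Pproj V (dot (x0 w))};
  euler_step : forall j, (j < N)%N -> {ae P, forall w,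
    X j.+1 w - X j w =
      dt *: (Ah e lam V (X j.+1 w) + Pproj V (F (j%:R * dt) (X j w)))
      + dWG j w}
}.

Context {K : hilbertType R} (tens : H -> H -> K).

Definition mean_recursion (N : nat) (F1 : R -> H -> H -> R) (F2 : R -> H -> R)
    (mu : nat -> H) : Prop :=
  forall j, (j < N)%N -> Rop (mu j.+1) = F1op F1 j (mu j) + F2op F2 j.

Definition cov_recursion (N : nat) (F1 : R -> H -> H -> R)
    (dWG : nat -> Om -> H) (Sigma : nat -> K) : Prop :=
  forall j, (j < N)%N ->
    tens_op tens V Rop Rop (Sigma j.+1) =
      tens_op tens V (F1op F1 j) (F1op F1 j) (Sigma j)
      + second_moment P tens (dWG j).

End scheme.

(* Main.v *)
Require Import Defs.
From mathcomp Require Import all_boot all_order all_algebra.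
From mathcomp Require Import all_classical all_reals all_analysis.
From mathcomp Require Import measurable_realfun ring lra.

Set Implicit Arguments.
Unset Strict Implicit.
Unset Printing Implicit Defensive.

Import Order.TTheory GRing.Theory Num.Theory.
Import numFieldNormedType.Exports.

Local Open Scope classical_set_scope.
Local Open Scope ring_scope.

(* Fix an orthonormal basis of V_h. Since -A_h is positive semidefinite,
   R = I - dt A_h satisfies |f| <= |R f| on V_h, so the scheme reads
   R X_(j+1) = F^1 X_j + F^2 + dWG_j and square integrability propagates in j.
   Taking expectations gives the mean recursion; taking second moments of the
   centred identity gives the covariance recursion once the cross terms vanish.

   For the cross terms no measurability of X_j with respect to F_(t_j) is
   propagated. Instead, one shows by induction that E[(W_b u - W_a u) X_j] = 0
   for all t_j <= a <= b <= T: the Ito integral inherits orthogonality to a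
   square integrable variable from the increments it is a limit of, and the
   implicit step preserves orthogonality because R is injective. Adaptedness is
   used only for x_0 and for W itself. The same limit argument then turns the
   orthogonality of X_j to the increments over [t_j, t_(j+1)] into that of X_j
   to dWG_j. *)

(** * Moments of normal variables and independence *)

(** The objects [expect], [tens_op], [Pproj] and [neg_Ah] are all picked by [xget], so each can be
    computed with only once the picked value is known to exist and to be unique. A finite
    orthonormal basis supplies explicit coordinate sums for all of them. Propagating adaptedness
    would mean carrying measurability for F_(t_j) through identities that hold only almost
    everywhere, through an L^2-limit and through the inverse of R. Orthogonality is a statement
    about expectations, which ignore null sets and are continuous in L^2. That the recursions
    determine the mean and the covariance is a further claim: it rests on the injectivity of R on
    V_h and of R (x) R on the tensor square of V_h. *)

Section normal_moments.
Context {R : realType}.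
Implicit Types m s : R.
Notation leb := (@lebesgue_measure R).

(** The Radon-Nikodym derivative and [normal_pdf] have the same integral over every measurable set,
    hence agree almost everywhere, and the change of variables formula may use either. *)
Lemma ge0_integral_normal_prob m s (f : R -> \bar R) :
  measurable_fun setT f -> (forall x, (0 <= f x)%E) ->
  (\int[normal_prob m s]_x f x = \int[leb]_x (f x * (normal_pdf m s x)%:E))%E.
Proof.
move=> mf f0.
have dom := normal_prob_dominates m s.
rewrite -(Radon_Nikodym_SigmaFinite.change_of_variables dom f0 measurableT mf).
have mrn : measurable_fun setT
    (Radon_Nikodym_SigmaFinite.f (normal_prob m s) leb).
  exact: measurable_int (Radon_Nikodym_SigmaFinite.f_integrable dom).
have mpdf : measurable_fun setT (fun x : R => (normal_pdf m s x)%:E).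
  by apply/measurable_EFinP; exact: measurable_normal_pdf.
apply: ae_eq_integral => //.
- by apply: emeasurable_funM.
- by apply: emeasurable_funM.
- apply: ae_eqe_mul2l; apply: integral_ae_eq => //.
  + exact: Radon_Nikodym_SigmaFinite.f_integrable.
  + by move=> A _ mA; rewrite -Radon_Nikodym_SigmaFinite.f_integral.
Qed.

(* With u = (x - m)^2 / (4 s^2), the bound u <= exp u trades the factor
   (x - m)^2 for a doubling of the variance. *)
Lemma sqr_normal_pdf_le m s : s != 0 -> exists2 C : R, 0 <= C &
  forall x, (x - m) ^+ 2 * normal_pdf m s x
    <= C * normal_pdf m (s * Num.sqrt 2) x.
Proof.
move=> s0; set s2 := s * Num.sqrt 2.
have s20 : s2 != 0 by rewrite mulf_neq0// sqrtr_eq0 -ltNge.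
have ss : s2 ^+ 2 = s ^+ 2 * 2 by rewrite exprMn sqr_sqrtr.
have sp : 0 < s ^+ 2 by rewrite exprn_even_gt0.
exists (4 * s ^+ 2 * normal_peak s / normal_peak s2).
  by rewrite divr_ge0 ?normal_peak_ge0// mulr_ge0 ?normal_peak_ge0//
    mulr_ge0 ?sqr_ge0.
move=> x; rewrite !normal_pdfE// /normal_fun ss.
have p2 := normal_peak_gt0 s20.
rewrite [leRHS]mulrA divfK ?gt_eqF//.
rewrite mulrCA -[leRHS]mulrA [leRHS]mulrCA ler_wpM2l ?normal_peak_ge0//.
set u := (x - m) ^+ 2 / (4 * s ^+ 2).
have -> : (x - m) ^+ 2 = 4 * s ^+ 2 * u.
  by rewrite /u mulrC divfK// gt_eqF// mulr_gt0.
(* The exponent of the density is [- 2u] and that of the density with doubled variance is [- u], so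
   one factor [expR (- u)] is left over to absorb [u]. *)
have -> : - (4 * s ^+ 2 * u) / (s ^+ 2 *+ 2) = - u + - u.
  rewrite -mulr_natr; by field.
have -> : - (4 * s ^+ 2 * u) / (s ^+ 2 * 2 *+ 2) = - u.
  rewrite -mulr_natr; by field.
have ue : u * expR (- u) <= 1.
  rewrite expRN ler_pdivrMr ?expR_gt0// mul1r.
  by rewrite (le_trans _ (expR_ge1Dx u))// lerDr.
have c0 : 0 <= 4 * s ^+ 2 by rewrite mulr_ge0 ?ltW.
rewrite -subr_ge0 in ue; have := mulr_ge0 (mulr_ge0 c0 (expR_ge0 (- u))) ue.
rewrite expRD -subr_ge0 => /le_trans; apply.
by rewrite le_eqVlt; apply/orP; left; apply/eqP; ring.
Qed.

Lemma normal_prob_sqr_lty m s : s != 0 ->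
  (\int[normal_prob m s]_x (x ^+ 2)%:E < +oo)%E.
Proof.
move=> s0; have [C C0 HC] := sqr_normal_pdf_le m s0.
have mx2 : measurable_fun [set: R] (fun x : R => (x ^+ 2)%:E).
  by apply/measurable_EFinP; exact: measurable_funX.
rewrite ge0_integral_normal_prob//; last by move=> x; rewrite lee_fin sqr_ge0.
set s2 := s * Num.sqrt 2.
have mpdf s' : measurable_fun setT (fun x : R => (normal_pdf m s' x)%:E).
  by apply/measurable_EFinP; exact: measurable_normal_pdf.
apply: (@le_lt_trans _ _ (\int[leb]_x ((2 * C)%:E * (normal_pdf m s2 x)%:E +
   (2 * m ^+ 2)%:E * (normal_pdf m s x)%:E))%E); last first.
  rewrite ge0_integralD//=; last 4 first.
  - by move=> x _; rewrite -EFinM lee_fin mulr_ge0 ?normal_pdf_ge0// mulr_ge0.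
  - exact: (measurable_funeM _ (mpdf _)).
  - by move=> x _; rewrite -EFinM lee_fin mulr_ge0 ?normal_pdf_ge0//
      mulr_ge0 ?sqr_ge0.
  - exact: (measurable_funeM _ (mpdf _)).
  have pdf0 s' x : (0 <= (normal_pdf m s' x)%:E)%E.
    by rewrite lee_fin normal_pdf_ge0.
  have m2 : 0 <= 2 * m ^+ 2 by rewrite mulr_ge0 ?sqr_ge0.
  have C2 : 0 <= 2 * C by rewrite mulr_ge0.
  rewrite ge0_integralZl//; last exact: mpdf.
  rewrite ge0_integralZl//; last exact: mpdf.
  by rewrite !integral_normal_pdf !mule1 -EFinD ltry.
apply: ge0_le_integral => //.
- by move=> x _; rewrite -EFinM lee_fin mulr_ge0 ?sqr_ge0 ?normal_pdf_ge0.
- exact: (emeasurable_funM mx2 (mpdf _)).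
- exact: (emeasurable_funD (measurable_funeM _ (mpdf _))
    (measurable_funeM _ (mpdf _))).
move=> x _; rewrite -!EFinM -EFinD lee_fin.
(* The bound on [x ^+ 2] is equivalent to [0 <= (x - 2m)^2]. *)
apply: (@le_trans _ _ ((2 * (x - m) ^+ 2 + 2 * m ^+ 2) * normal_pdf m s x)).
  rewrite ler_wpM2r ?normal_pdf_ge0//.
  by have := sqr_ge0 (x - m - m); rewrite expr2; lra.
by have := HC x; rewrite -/s2 mulrDl lerD2r; lra.
Qed.

(** The centred density is even and Lebesgue measure is invariant under reflection. This symmetry
    yields the vanishing mean without integrating against the density. *)
Lemma normal_probN s (A : set R) : s != 0 -> measurable A ->
  normal_prob 0 s (-%R @^-1` A) = normal_prob 0 s A.
Proof.
move=> s0 mA; rewrite /normal_prob.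
have e x : normal_pdf 0 s (- x) = normal_pdf 0 s x :> R.
  by rewrite !normal_pdfE// /normal_fun !subr0 sqrrN.
under eq_integral do rewrite -e.
have := @ge0_integral_pushforward _ _ (measurableTypeR R) (measurableTypeR R) R
  -%R (@oppr_measurable R setT) leb A (fun x => (normal_pdf 0 s x)%:E) mA.
rewrite /comp => <-; last 2 first.
- by apply/measurable_funTS/measurable_EFinP; exact: measurable_normal_pdf.
- by move=> x _; rewrite lee_fin normal_pdf_ge0.
by apply: eq_measure_integral => B mB _; exact: lebesgue_measureN.
Qed.

End normal_moments.

Section random_variables.
Context {R : realType} {d : measure_display} {Om : measurableType d}.
Context (P : probability Om R).
Implicit Types X Y Z : Om -> R.
Notation L1 := (Lfun P 1).
Notation L2 := (Lfun P 2).

Lemma Lfun_measurable (p : \bar R) X : X \in Lfun P p -> measurable_fun setT X.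
Proof. by move/sub_Lfun_mfun => /[!inE]. Qed.

Lemma Lfun2_Lfun1 X : X \in L2 -> X \in L1.
Proof. by apply: Lfun_subset12; exact: fin_num_measure. Qed.

Lemma Lfun2P X : X \in L2 <->
  measurable_fun setT X /\ ('E_P[fun w => (X w ^+ 2)%R] < +oo)%E.
Proof.
split=> [X2|[mX X2]].
  split; first exact: Lfun_measurable X2.
  have /integrableP[_] := Lfun2_integrable_sqr X2.
  rewrite unlock; under eq_integral do rewrite /= ger0_norm ?sqr_ge0//.
  by [].
rewrite inE; apply/andP; split; rewrite inE//=.
rewrite /finite_norm unlock /Lnorm poweR_lty//=.
move: X2; rewrite unlock; congr (_ < _)%E; apply: eq_integral => w _.
by rewrite powR_mulrn// real_normK ?num_real.
Qed.

Lemma Lfun2_mul X Y : X \in L2 -> Y \in L2 -> (fun w => X w * Y w) \in L1.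
Proof. exact: Lfun2_mul_Lfun1. Qed.

Lemma Lfun_lin (p : \bar R) (p1 : (1 <= p)%E) (a : R) X Y :
  X \in Lfun P p -> Y \in Lfun P p -> (fun w => a * X w + Y w) \in Lfun P p.
Proof. by move=> XP YP; have := (Lfun_submod_closed P p1).2 a _ _ XP YP. Qed.

Lemma Lfun2_lin (a : R) X Y :
  X \in L2 -> Y \in L2 -> (fun w => a * X w + Y w) \in L2.
Proof. by apply: Lfun_lin; rewrite lee1n. Qed.

Lemma expectation_lin (a : R) X Y : X \in L1 -> Y \in L1 ->
  ('E_P[fun w => (a * X w + Y w)%R] = a%:E * 'E_P[X] + 'E_P[Y])%E.
Proof.
move=> X1 Y1.
have aX : a \o* X \in L1 by exact: Lfun_scale.
rewrite -expectationZl// -expectationD//; congr expectation.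
by apply/funext => w /=; rewrite mulrC.
Qed.

Lemma ae_eq_expectation X Y : measurable_fun setT X -> measurable_fun setT Y ->
  {ae P, forall w, X w = Y w} -> ('E_P[X] = 'E_P[Y])%E.
Proof.
move=> mX mY XY; rewrite unlock; apply: ae_eq_integral => //.
- exact/measurable_EFinP.
- exact/measurable_EFinP.
- by apply: filterS XY => w /= -> _.
Qed.

Lemma ae_eq_Lfun2 X Y : measurable_fun setT Y ->
  {ae P, forall w, X w = Y w} -> X \in L2 -> Y \in L2.
Proof.
move=> mY XY /Lfun2P[mX X2]; apply/Lfun2P; split=> //.
rewrite -(@ae_eq_expectation (fun w => X w ^+ 2))//; try exact: measurable_funX.
by apply: filterS XY => w /= ->.
Qed.

Lemma ae_eq_Lfun1 X Y : measurable_fun setT Y ->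
  {ae P, forall w, X w = Y w} -> X \in L1 -> Y \in L1.
Proof.
move=> mY XY X1; apply/Lfun1_integrable.
have mX := Lfun_measurable X1.
have /integrableP[_ fX] := (Lfun1_integrable P X).1 X1.
apply/integrableP; split; first exact/measurable_EFinP.
suff <- : (\int[P]_x `|(EFin \o X) x| = \int[P]_x `|(EFin \o Y) x|)%E by [].
apply: ae_eq_integral => //.
- by apply/measurable_EFinP/measurableT_comp.
- by apply/measurable_EFinP/measurableT_comp.
- by apply: filterS XY => w /= -> _.
Qed.

Section normal.
Variables (Y : Om -> R) (m v : R) (Ymv : has_normal_law P Y m v).

Let mY : measurable_fun setT Y := Ymv.1.

Let ge0_law (f : R -> \bar R) : measurable_fun [set: R] f ->
  (forall x, (0 <= f x)%E) -> v != 0 ->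
  (\int[P]_w f (Y w) = \int[normal_prob m (Num.sqrt v)]_x f x)%E.
Proof.
move=> mf f0 v0.
pose Y' := @mfun_Sub _ _ Om (measurableTypeR R) Y (mem_set mY).
rewrite -(@ge0_integral_distribution _ _ Om (measurableTypeR R) R P Y' f mf f0).
apply: eq_measure_integral => A mA _.
by have := Ymv.2 A mA; rewrite /normal_law (negbTE v0).
Qed.

Let dirac_ae : v = 0 -> {ae P, forall w, Y w = m}.
Proof.
move=> v0; exists (Y @^-1` (~` [set m])); split.
- rewrite -[X in measurable X]setTI; apply: mY => //.
  by apply: measurableC; exact: measurable_set1.
- have mC : measurable (~` [set m]) by apply: measurableC;
    exact: measurable_set1.
  have := Ymv.2 _ mC; rewrite /normal_law v0 eqxx => ->.
  by rewrite diracE memNset//=; apply.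
- by move=> w.
Qed.

Lemma normal_law_Lfun2 : 0 <= v -> Y \in L2.
Proof.
move=> v0; have [ve|vn0] := eqVneq v 0.
  apply: (@ae_eq_Lfun2 (cst m)) => //; last exact: Lfun_cst.
  by apply: filterS (dirac_ae ve) => w ->.
apply/Lfun2P; split=> //.
rewrite unlock (@ge0_law (fun x => (x ^+ 2)%:E))//.
- by apply: normal_prob_sqr_lty; rewrite sqrtr_eq0 -ltNge lt_neqAle eq_sym vn0.
- by apply/measurable_EFinP; exact: measurable_funX.
- by move=> x; rewrite lee_fin sqr_ge0.
Qed.

(** In the nondegenerate case [Y] and [- Y] have the same law, so the expectation equals its own
    opposite; it is finite by square integrability. In the degenerate case [Y] is almost surely the
    constant [m]. *)
Lemma normal_law_expectation0 : 0 <= v -> m = 0 -> ('E_P[Y] = 0)%E.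
Proof.
move=> v0 m0; have [ve|vn0] := eqVneq v 0.
  rewrite (@ae_eq_expectation _ (cst m))//; first by rewrite expectation_cst m0.
  exact: dirac_ae.
set s := Num.sqrt v.
have s0 : s != 0 by rewrite sqrtr_eq0 -ltNge lt_neqAle eq_sym vn0.
have Y1 := Lfun2_Lfun1 (normal_law_Lfun2 v0).
have iY := (Lfun1_integrable P Y).1 Y1.
have mE : measurable_fun [set: R] (@EFin R) by apply/measurable_EFinP.
have mN : measurable_fun [set: R] (fun x : R => (- x)%:E).
  by apply/measurable_EFinP; exact: oppr_measurable.
have mNY : measurable_fun setT (fun w => - Y w) by exact: measurableT_comp.
have iNY : P.-integrable setT (EFin \o (fun w => - Y w)).
  apply/Lfun1_integrable; rewrite (_ :
    (fun _ => _) = (fun w => (-1) * Y w + 0)).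
    by apply: Lfun_lin => //; exact: Lfun_cst.
  by apply/funext => w; rewrite mulN1r addr0.
pose Y' := @mfun_Sub _ _ Om (measurableTypeR R) _ (mem_set mY).
pose NY' := @mfun_Sub _ _ Om (measurableTypeR R) _ (mem_set mNY).
have e1 := @integral_distribution _ _ _ (measurableTypeR R) _ P Y' _ mE iY.
have e2 := @integral_distribution _ _ _ (measurableTypeR R) _ P NY' _ mE iNY.
have e3 : (\int[P]_w (Y w)%:E = \int[P]_w (- Y w)%:E)%E.
  rewrite -[LHS]e1 -[RHS]e2.
  apply: eq_measure_integral => A mA _.
  have mNA : measurable (-%R @^-1` A).
    by rewrite -[X in measurable X]setTI; exact: oppr_measurable.
  have := Ymv.2 A mA; have := Ymv.2 _ mNA.
  rewrite /normal_law (negbTE vn0) m0 -/s normal_probN// => <- e4.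
  exact: e4.
rewrite unlock.
have fY : (\int[P]_w (Y w)%:E)%E \is a fin_num.
  exact: integrable_fin_num.
move: e3.
have -> : (\int[P]_w (- Y w)%:E = - \int[P]_w (Y w)%:E)%E.
  by rewrite -integralN//; apply: integrable_add_def.
move: fY; case: (X in X \is a fin_num -> _) => //= r _ [] /eqP.
by rewrite -addr_eq0 -mulr2n mulrn_eq0 /= => /eqP ->.
Qed.

End normal.

Lemma gaussian_Lfun2 Y : gaussian P Y -> Y \in L2.
Proof. by move=> [m [v [v0 Ymv]]]; exact: normal_law_Lfun2 Ymv v0. Qed.

Section independence.
Variables (F0 : set (set Om)) (Y Z : Om -> R).
Hypotheses (YF0 : sub_measurable F0 Y) (ZF0 : indep_of P F0 Z) (Y2 :
  Y \in L2) (Z2 : Z \in L2).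

(** On rectangles the law of [(Y, Z)] is the product of the two laws, since [Y] only produces events
    of [F0]; a product measure is determined by rectangles. By Fubini the inner integral over the
    law of [Z] vanishes for each value of [Y]. *)
Lemma indep_expectation0 : ('E_P[Z] = 0)%E ->
  ('E_P[fun w => (Y w * Z w)%R] = 0)%E.
Proof.
move=> EZ.
have mY := Lfun_measurable Y2; have mZ := Lfun_measurable Z2.
have mYZ : measurable_fun setT (fun w => (Y w, Z w))
  by exact: measurable_fun_pair.
pose Y' := mfun_Sub (mem_set mY); pose Z' := mfun_Sub (mem_set mZ).
pose YZ' := mfun_Sub (mem_set mYZ).
pose f (z : R * R) := (z.1 * z.2)%:E.
have mf : measurable_fun [set: R * R] f.
  by apply/measurable_EFinP; apply: measurable_funM;
    [exact: measurable_fst|exact: measurable_snd].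
have prodE (X : set (R * R)) : measurable X ->
    (distribution P Y' \x distribution P Z')%E X = distribution P YZ' X.
  apply: product_measure_unique => A B mA mB.
  rewrite [RHS]muleC; have := ZF0 mB (YF0 mA).
  rewrite /distribution /pushforward /= => <-; congr (P _).
  by rewrite setIC; apply/seteqP; split.
have iYZ := (Lfun1_integrable P _).1 (Lfun2_mul Y2 Z2).
have iprod : (distribution P Y' \x distribution P Z')%E.-integrable setT f.
  apply/integrableP; split=> //.
  rewrite (eq_measure_integral (distribution P YZ')); last first.
    by move=> A mA _; exact: prodE.
  have /integrableP[_] := @integrable_pushforward _ _ _ _ R _ mYZ P setT f mf
    iYZ measurableT.
  by [].
rewrite unlock.
have -> : (\int[P]_w (Y w * Z w)%:E = \int[distribution P YZ']_z f z)%E.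
  by rewrite integral_distribution.
transitivity (\int[(distribution P Y' \x distribution P Z')%E]_z f z)%E.
  by apply/esym/eq_measure_integral => A mA _; exact: prodE.
rewrite -integral12_prod_meas1//.
have EZ' : (\int[distribution P Z']_y y%:E = 0)%E.
  rewrite integral_distribution//; first by move: EZ; rewrite unlock.
  exact/Lfun1_integrable/Lfun2_Lfun1.
have iZ' : (distribution P Z').-integrable setT (EFin : R -> \bar R).
  apply: (@integrable_pushforward _ _ _ _ R _ mZ P setT) => //.
  exact/Lfun1_integrable/Lfun2_Lfun1.
rewrite (eq_integral (cst 0%E)) ?integral0// => y _.
rewrite /fubini_F /f /=; under eq_integral do rewrite EFinM.
by rewrite integralZl//= EZ' mule0.
Qed.

End independence.

End random_variables.

(** * Orthogonality under limits in L^2 *)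

Section L2_closure.
Context {R : realType} {d : measure_display} {Om : measurableType d}.
Context (P : probability Om R).
Implicit Types X Y Z : Om -> R.
Notation L1 := (Lfun P 1).
Notation L2 := (Lfun P 2).

Lemma cvge0_near_lt (a : nat -> \bar R) (eps : R) : 0 < eps ->
  a @ \oo --> 0%E -> exists k, (a k < eps%:E)%E.
Proof.
move=> e0 /(_ [set x : \bar R | (x < eps%:E)%E]) [].
  by apply: open_nbhs_nbhs; split;
    [exact: open_ereal_lt_ereal|rewrite /= lte_fin].
by move=> k _ /(_ k (leqnn k)) ak; exists k.
Qed.

Lemma Lfun2_expectationM_fin X Y : X \in L2 -> Y \in L2 ->
  exists r : R, ('E_P[fun w => (X w * Y w)%R] = r%:E)%E.
Proof.
move=> X2 Y2; exists (fine 'E_P[fun w => (X w * Y w)%R]%E).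
by rewrite fineK// expectation_fin_num// Lfun2_mul.
Qed.

Lemma expectation_sqr X :
  ('E_P[fun w => (X w ^+ 2)%R] = 'E_P[fun w => (X w * X w)%R])%E.
Proof. by []. Qed.

(** Weighted Young inequality: expand the expectation of [eps * (eps^-1 * X - c * Y) ^+ 2], which is
    nonnegative, with [c] the sign of the mixed moment. *)
Lemma expectationM_le (eps : R) X Y : 0 < eps -> X \in L2 -> Y \in L2 ->
  (2%:E * `|'E_P[fun w => (X w * Y w)%R]|
    <= eps^-1%:E * 'E_P[fun w => (X w ^+ 2)%R]
       + eps%:E * 'E_P[fun w => (Y w ^+ 2)%R])%E.
Proof.
move=> e0 X2 Y2.
have [x Ex] := Lfun2_expectationM_fin X2 X2.
have [y Ey] := Lfun2_expectationM_fin Y2 Y2.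
have [r Er] := Lfun2_expectationM_fin X2 Y2.
have key (c : R) : c ^+ 2 = 1 -> 2 * c * r <= eps^-1 * x + eps * y.
  move=> c2; rewrite -lee_fin EFinD !EFinM -Ex -Ey -Er.
  have X1 := Lfun2_mul X2 X2; have Y1 := Lfun2_mul Y2 Y2.
  have XY := Lfun2_mul X2 Y2.
  have eY : (fun w => eps * (Y w * Y w) + 0) \in L1.
    by apply: Lfun_lin => //; exact: Lfun_cst.
  have : (0 <= 'E_P[fun w => (eps^-1 * (X w * X w) +
      ((- (2 * c)) * (X w * Y w) + (eps * (Y w * Y w) + 0)))%R])%E.
    apply: expectation_ge0 => w.
    have -> : eps^-1 * (X w * X w) +
      ((- (2 * c)) * (X w * Y w) + (eps * (Y w * Y w) + 0))
      = eps * (eps^-1 * X w - c * Y w) ^+ 2 + (eps * (1 - c ^+ 2)) * Y w ^+ 2.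
      by field; rewrite gt_eqF.
    by rewrite c2 subrr mulr0 mul0r addr0 mulr_ge0 ?sqr_ge0 ?ltW.
  have XYY := Lfun_lin (lexx 1%E) (- (2 * c)) XY eY.
  rewrite !expectation_lin//; last exact: Lfun_cst.
  rewrite expectation_cst Ex Ey Er -!EFinM -!EFinD !lee_fin; lra.
rewrite !expectation_sqr.
rewrite Ex Ey Er -!EFinM -EFinD lee_fin.
have [r0|r0] := leP 0 r.
  by have := key 1 (expr1n _ _); rewrite mulr1 ger0_norm.
by have := key (-1) (sqrr_sign R 1); rewrite mulrN1 mulNr ltr0_norm// mulrN.
Qed.

Lemma Lfun2_cvg_expectation0 X (Y_ : nat -> Om -> R) Z :
  X \in L2 -> Z \in L2 -> (forall k, Y_ k \in L2) ->
  ('E_P[fun w => ((X w - Y_ k w) ^+ 2)%R])%E @[k --> \oo] --> 0%E ->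
  (forall k, 'E_P[fun w => (Y_ k w * Z w)%R] = 0)%E ->
  ('E_P[fun w => (X w * Z w)%R] = 0)%E.
Proof.
move=> X2 Z2 Y2 cXY EYZ.
have [z Ez] := Lfun2_expectationM_fin Z2 Z2.
have [r Er] := Lfun2_expectationM_fin X2 Z2.
have z0 : 0 <= z.
  by rewrite -lee_fin -Ez; apply: expectation_ge0 => w; rewrite -expr2 sqr_ge0.
rewrite Er; congr EFin; apply/eqP/negPn/negP; rewrite -normr_gt0 => r0.
(* This choice gives [eps * z <= |r|], and [k] is then taken so large that the other term of Young's
   inequality is below [|r|]; together they say [2|r| < 2|r|]. The [+ 1] covers [z = 0]. *)
pose eps := `|r| / (z + 1).
have e0 : 0 < eps by rewrite divr_gt0// ltr_wpDl.
have [k] := cvge0_near_lt (mulr_gt0 e0 r0) cXY.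
have D2 : (fun w => X w - Y_ k w) \in L2.
  rewrite (_ : (fun _ => _) = (fun w => (-1) * Y_ k w + X w)).
    exact: Lfun2_lin.
  by apply/funext => w; rewrite mulN1r addrC.
have := expectationM_le e0 D2 Z2.
have -> : ('E_P[fun w => ((X w - Y_ k w) * Z w)%R] = r%:E)%E.
  rewrite -Er (_ : (fun _ => _) = (fun w => (-1) * (Y_ k w * Z w) + X w * Z w)).
    by rewrite expectation_lin ?Lfun2_mul// EYZ mule0 add0e.
  by apply/funext => w; ring.
have [x Ex] := Lfun2_expectationM_fin D2 D2.
rewrite !expectation_sqr.
rewrite Ex Ez -!EFinM -EFinD lee_fin lte_fin => h1 h2.
have h3 : eps * z <= `|r|.
  by rewrite /eps mulrAC ler_pdivrMr ?ltr_wpDl// mulrDr mulr1 lerDl ltW.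
have h4 : eps^-1 * x < `|r| by rewrite ltr_pdivrMl.
by have := le_lt_trans h1 (ltr_leD h4 h3); rewrite mulr_natl mulr2n ltxx.
Qed.

End L2_closure.

(** * Orthonormal bases and operators on tensors *)

Section inner_product.
Context {R : realType} {H : hilbertType R}.
Implicit Types x y z : H.

Lemma dotDl x y z : dot (x + y) z = dot x z + dot y z.
Proof. by have := dot_linearl 1 x y z; rewrite scale1r mul1r. Qed.

Lemma dot0l x : dot 0 x = 0.
Proof. by have /eqP := dotDl 0 0 x;
  rewrite addr0 -subr_eq0 opprD addNKr oppr_eq0 => /eqP. Qed.

Lemma dotZl (a : R) x y : dot (a *: x) y = a * dot x y.
Proof. by have := dot_linearl a x 0 y; rewrite addr0 dot0l addr0. Qed.

Lemma dotNl x y : dot (- x) y = - dot x y.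
Proof. by rewrite -scaleN1r dotZl mulN1r. Qed.

Lemma dotBl x y z : dot (x - y) z = dot x z - dot y z.
Proof. by rewrite dotDl dotNl. Qed.

Lemma dotDr x y z : dot z (x + y) = dot z x + dot z y.
Proof. by rewrite dotC dotDl !(dotC z). Qed.

Lemma dotZr (a : R) x y : dot y (a *: x) = a * dot y x.
Proof. by rewrite dotC dotZl dotC. Qed.

Lemma dotBr x y z : dot z (x - y) = dot z x - dot z y.
Proof. by rewrite dotC dotBl !(dotC z). Qed.

Lemma dot_suml (I : Type) (r : seq I) (Q : pred I) (F : I -> H) y :
  dot (\sum_(i <- r | Q i) F i) y = \sum_(i <- r | Q i) dot (F i) y.
Proof.
by elim/big_rec2: _ => [|i u v _ <-]; rewrite ?dot0l// dotDl.
Qed.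

Lemma dot_sumr (I : Type) (r : seq I) (Q : pred I) (F : I -> H) y :
  dot y (\sum_(i <- r | Q i) F i) = \sum_(i <- r | Q i) dot y (F i).
Proof. by rewrite dotC dot_suml; apply: eq_bigr => i _; rewrite dotC. Qed.

Lemma dot_ge0 x : 0 <= dot x x.
Proof. by rewrite dot_norm sqr_ge0. Qed.

Lemma dot_eq0 x : dot x x = 0 -> x = 0.
Proof. by rewrite dot_norm => /eqP; rewrite sqrf_eq0 normr_eq0 => /eqP. Qed.

Lemma dot_inj x y : (forall z, dot x z = dot y z) -> x = y.
Proof.
by move=> xy; apply/eqP; rewrite -subr_eq0; apply/eqP/dot_eq0;
  rewrite dotBl xy subrr.
Qed.

Lemma cauchy_schwarz x y : `|dot x y| <= `|x| * `|y|.
Proof.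
have [->|y0] := eqVneq y 0; first by rewrite dotC dot0l !normr0 mulr0.
have yp : 0 < `|y| by rewrite normr_gt0.
rewrite -(@ler_pXn2r _ 2)// ?nnegrE ?mulr_ge0// exprMn.
have := dot_ge0 (`|y| ^+ 2 *: x - dot x y *: y).
rewrite !(dotBl, dotBr, dotZl, dotZr) (dotC y x) !dot_norm real_normK
  ?num_real//.
set a := dot x y; set nx := `|x| ^+ 2; set ny := `|y| ^+ 2 => h.
have nyp : 0 < ny by rewrite exprn_gt0.
rewrite -(ler_pM2l nyp) -subr_ge0; apply: le_trans h _.
by rewrite le_eqVlt; apply/orP; left; apply/eqP; ring.
Qed.

Lemma dot_continuous y : continuous (fun x => dot x y).
Proof.
move=> x; apply/cvgrPdist_lt => e e0.
near=> z; rewrite -dotBl (le_lt_trans (cauchy_schwarz _ _))//.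
rewrite (@le_lt_trans _ _ (`|x - z| * (`|y| + 1)))//.
  by rewrite ler_wpM2l// lerDl.
rewrite -ltr_pdivlMr ?ltr_wpDl//.
near: z; apply: (@cvgr_dist_lt _ _ _ _ _ id x); first exact: cvg_id.
by rewrite divr_gt0// ltr_wpDl.
Unshelve. all: by end_near. Qed.

End inner_product.

Section linear_on_subspaces.
Context {R : realType} {U W : lmodType R}.
Variables (D : set U) (B : U -> W).
Hypotheses (DS : is_subspace D) (DB : linear_on D B).

Lemma subspaceZ a x : D x -> D (a *: x).
Proof. by move=> Dx; rewrite -[_ *: _]addr0; apply: DS.2 => //;
  exact: DS.1. Qed.

Lemma subspaceD x y : D x -> D y -> D (x + y).
Proof. by move=> Dx Dy; rewrite -[x]scale1r; exact: DS.2. Qed.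

Lemma subspaceB x y : D x -> D y -> D (x - y).
Proof. by move=> Dx Dy; rewrite addrC -scaleN1r; exact: DS.2. Qed.

Lemma subspace_sum (I : finType) (F : I -> U) :
  (forall i, D (F i)) -> D (\sum_i F i).
Proof.
by move=> DF; elim/big_rec: _ => [|i x _ Dx]; [exact: DS.1|exact: subspaceD].
Qed.

Lemma linear_on0 : B 0 = 0.
Proof.
have := DB (-1) DS.1 DS.1; rewrite addr0 scaler0 => ->.
by rewrite scaleN1r addNr.
Qed.

Lemma linear_onD x y : D x -> D y -> B (x + y) = B x + B y.
Proof. by move=> Dx Dy; have := DB 1 Dx Dy; rewrite !scale1r. Qed.

Lemma linear_onZ a x : D x -> B (a *: x) = a *: B x.
Proof.
by move=> Dx; have := DB a Dx DS.1; rewrite linear_on0 !addr0.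
Qed.

Lemma linear_onB x y : D x -> D y -> B (x - y) = B x - B y.
Proof.
by move=> Dx Dy; rewrite addrC -scaleN1r DB// scaleN1r addrC.
Qed.

Lemma linear_on_sum (I : finType) (F : I -> U) : (forall i, D (F i)) ->
  B (\sum_i F i) = \sum_i B (F i).
Proof.
move=> DF; suff [_ ->] : D (\sum_i F i) /\ B (\sum_i F i) = \sum_i B (F i)
  by [].
elim/big_rec2: _ => [|i x y _ [Dy <-]]; first by split;
  [exact: DS.1|exact: linear_on0].
by split; [exact: subspaceD|rewrite linear_onD].
Qed.

End linear_on_subspaces.

Section orthonormal_bases.
Context {R : realType} {H : hilbertType R}.

(** Finite counterpart of [orthonormal_basis]: the expansion is exact, so neither density nor limits
    enter. *)
Record onb (V : set H) (n : nat) (b : 'I_n -> H) : Prop := {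
  onb_mem : forall i, V (b i);
  onb_dot : forall i j, dot (b i) (b j) = (i == j)%:R;
  onb_expand : forall v, V v -> v = \sum_i dot v (b i) *: b i
}.

Lemma fin_dim_is_subspace (V : set H) : fin_dim_subspace V -> is_subspace V.
Proof.
move=> [n [b ->]]; split.
  by exists (fun=> 0); rewrite big1// => i _; rewrite scale0r.
move=> a _ _ [c ->] [c' ->]; exists (fun i => a * c i + c' i).
rewrite scaler_sumr -big_split; apply: eq_bigr => i _ /=.
by rewrite scalerDl scalerA.
Qed.

(** The spanning family may be dependent, whence the separate length [m]: if the first vector
    already lies in the span of the others, their basis is kept; otherwise its normalised residual
    is added. *)
Lemma gram_schmidt (n : nat) (b : 'I_n -> H) : exists m (f : 'I_m -> H),
  onb [set x | exists c : 'I_n -> R, x = \sum_i c i *: b i] f.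
Proof.
elim: n b => [|n IH] b.
  exists 0%N, (fun=> 0); split=> [i|i|v [c ->]]; [by case: i|by case: i|].
  by rewrite !big_ord0.
have [m [f [oV odot oe]]] := IH (b \o lift ord0).
set V' := [set x | _] in oV oe.
set V := [set x | _].
have VE x : V x <-> exists (a : R) (v : H), V' v /\ x = a *: b ord0 + v.
  split=> [[c ->]|[a [_ [[c ->] ->]]]].
    exists (c ord0), (\sum_i c (lift ord0 i) *: b (lift ord0 i)).
    by split; [exists (c \o lift ord0)|rewrite big_ord_recl].
  exists (fun i => if unlift ord0 i is Some k then c k else a).
  rewrite big_ord_recl unlift_none; congr (_ + _).
  by apply: eq_bigr => i _; rewrite liftK.
have V'S : is_subspace V' by apply: fin_dim_is_subspace;
  exists n, (b \o lift ord0).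
pose p := \sum_i dot (b ord0) (f i) *: f i.
have V'p : V' p by apply: (subspace_sum V'S) => i; apply: (subspaceZ V'S).
pose r := b ord0 - p.
have bE : b ord0 = r + p by rewrite subrK.
have ro i : dot r (f i) = 0.
  rewrite dotBl dot_suml (bigD1 i)//= dotZl odot eqxx mulr1 big1 ?addr0
    ?subrr//.
  by move=> j /negbTE ji; rewrite dotZl odot ji mulr0.
have rV' v : V' v -> dot r v = 0.
  move=> /oe ->; rewrite dot_sumr big1// => i _.
  by rewrite dotZr ro mulr0.
have [r0|r0] := eqVneq r 0.
  exists m, f; split=> //.
  - by move=> i; apply/VE; exists 0, (f i); split=> //; rewrite scale0r add0r.
  - move=> x /VE[a [v [V'v ->]]]; apply: oe; apply: (V'S).2 => //.
    by rewrite bE r0 add0r.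
have nr : 0 < `|r| by rewrite normr_gt0.
pose q := `|r|^-1 *: r.
have qq : dot q q = 1.
  by rewrite dotZl dotZr dot_norm expr2 mulKf ?gt_eqF// mulVf ?gt_eqF.
have qV' v : V' v -> dot q v = 0 by move=> /rV' e; rewrite dotZl e mulr0.
pose o' (i : 'I_m.+1) := if unlift ord0 i is Some k then f k else q.
exists m.+1, o'; split.
- move=> i; apply/VE; rewrite /o'; case: unliftP => [j _|_].
    by exists 0, (f j); split=> //; rewrite scale0r add0r.
  exists `|r|^-1, (- `|r|^-1 *: p); split; first exact: (subspaceZ V'S).
  by rewrite scaleNr -scalerBr.
- move=> i j; rewrite /o'; case: unliftP => [k ->|->];
    case: unliftP => [l ->|->].
  + by rewrite odot (inj_eq (@lift_inj _ ord0)).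
  + by rewrite dotC qV'// eq_sym (negbTE (neq_lift _ _)).
  + by rewrite qV'// (negbTE (neq_lift _ _)).
  + by rewrite qq eqxx.
- move=> x /VE[a [v [V'v ->]]].
  rewrite big_ord_recl /o' unlift_none.
  under eq_bigr do rewrite liftK.
  have V'w : V' (a *: p + v) by apply: (V'S).2.
  have xE : a *: b ord0 + v = (a * `|r|) *: q + (a *: p + v).
    by rewrite scalerA mulfK ?gt_eqF// addrA -scalerDr -bE.
  rewrite xE; congr (_ + _).
    by rewrite dotDl dotZl qq (dotC (_ + _) q) qV'// addr0 mulr1.
  rewrite {1}(oe _ V'w); apply: eq_bigr => i _; congr (_ *: _).
  by rewrite (dotDl (_ *: q)) dotZl qV'// mulr0 add0r.
Qed.

Lemma onb_exists (V : set H) : fin_dim_subspace V ->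
  exists n (b : 'I_n -> H), onb V b.
Proof. by move=> [n [b ->]]; exact: gram_schmidt. Qed.

Lemma onb_linear (W : lmodType R) (V : set H) n (b : 'I_n -> H) (S : H -> W) v :
  is_subspace V -> onb V b -> linear_on V S -> V v ->
  S v = \sum_i dot v (b i) *: S (b i).
Proof.
move=> VS Vb SL Vv; rewrite {1}(onb_expand Vb Vv).
rewrite (linear_on_sum VS SL); last first.
  by move=> i; apply: (subspaceZ VS); exact: (onb_mem Vb).
by apply: eq_bigr => i _; rewrite (linear_onZ VS SL)//; exact: onb_mem Vb i.
Qed.

End orthonormal_bases.

Section tensor_operators.
Context {R : realType} {H K : hilbertType R} (tens : H -> H -> K).
Hypothesis tensH : hilbert_tensor tens.
Variables (V : set H) (n : nat) (b : 'I_n -> H).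
Hypotheses (VS : is_subspace V) (Vb : onb V b).

Lemma tens0l y : tens 0 y = 0.
Proof.
have := tens_linl tensH (-1) 0 0 y; rewrite addr0 scaler0 => ->.
by rewrite scaleN1r addNr.
Qed.

Lemma tens0r y : tens y 0 = 0.
Proof.
have := tens_linr tensH (-1) 0 0 y; rewrite addr0 scaler0 => ->.
by rewrite scaleN1r addNr.
Qed.

Lemma tensDl x y z : tens (x + y) z = tens x z + tens y z.
Proof. by have := tens_linl tensH 1 x y z; rewrite !scale1r. Qed.

Lemma tensDr x y z : tens z (x + y) = tens z x + tens z y.
Proof. by have := tens_linr tensH 1 x y z; rewrite !scale1r. Qed.

Lemma tensZl a x y : tens (a *: x) y = a *: tens x y.
Proof. by have := tens_linl tensH a x 0 y; rewrite tens0l !addr0. Qed.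

Lemma tensZr a x y : tens y (a *: x) = a *: tens y x.
Proof. by have := tens_linr tensH a x 0 y; rewrite tens0r !addr0. Qed.

Lemma tens_suml (I : finType) (F : I -> H) y :
  tens (\sum_i F i) y = \sum_i tens (F i) y.
Proof. by elim/big_rec2: _ => [|i u v _ <-]; rewrite ?tens0l// tensDl. Qed.

Lemma tens_sumr (I : finType) (F : I -> H) y :
  tens y (\sum_i F i) = \sum_i tens y (F i).
Proof. by elim/big_rec2: _ => [|i u v _ <-]; rewrite ?tens0r// tensDr. Qed.

(** A choice-free formula for S (x) S', using the coordinates of [k] along the orthonormal family
    [tens (b i) (b j)]. It is linear in [k] on the whole of [K]. *)
Definition tens_coord (S S' : H -> H) (k : K) : K :=
  \sum_i \sum_j dot k (tens (b i) (b j)) *: tens (S (b i)) (S' (b j)).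

Lemma tens_coord_linear S S' a k k' :
  tens_coord S S' (a *: k + k') = a *: tens_coord S S' k + tens_coord S S' k'.
Proof.
rewrite /tens_coord scaler_sumr -big_split; apply: eq_bigr => i _.
rewrite scaler_sumr -big_split; apply: eq_bigr => j _ /=.
by rewrite dotDl dotZl scalerDl scalerA.
Qed.

Lemma tens_coord_sum (I : finType) S S' (F : I -> K) :
  tens_coord S S' (\sum_i F i) = \sum_i tens_coord S S' (F i).
Proof.
elim/big_rec2: _ => [|i u v _ <-].
  by rewrite /tens_coord big1// => i _; rewrite big1// => j _;
    rewrite dot0l scale0r.
by rewrite -[X in tens_coord _ _ (X + _)]scale1r tens_coord_linear scale1r.
Qed.

Lemma tens_coord_tens S S' u v : linear_on V S -> linear_on V S' ->
  V u -> V v -> tens_coord S S' (tens u v) = tens (S u) (S' v).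
Proof.
move=> SL SL' Vu Vv; rewrite (onb_linear VS Vb SL Vu) (onb_linear VS Vb SL' Vv).
rewrite tens_suml; apply: eq_bigr => i _; rewrite tens_sumr.
by apply: eq_bigr => j _; rewrite tensZl tensZr scalerA (tens_dot tensH).
Qed.

Lemma tens_subspaceP k : tens_subspace tens V k <->
  exists m (u v : 'I_m -> H),
    (forall i, V (u i) /\ V (v i)) /\ k = \sum_i tens (u i) (v i).
Proof.
split=> [[m [c [s [sV ->]]]]|[m [u [v [uvV ->]]]]].
  have {}sV i : exists uv : H * H, [/\ V uv.1, V uv.2 & tens uv.1 uv.2 = s i].
    by have [x Vx [y Vy <-]] := sV i; exists (x, y).
  have [uv uvP] := choice sV.
  exists m, (fun i => c i *: (uv i).1), (fun i => (uv i).2); split=> [i|].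
    by have [Vx Vy _] := uvP i; split=> //; exact: subspaceZ.
  by apply: eq_bigr => i _; have [_ _ <-] := uvP i; rewrite tensZl.
exists m, (fun=> 1), (fun i => tens (u i) (v i)); split=> [i|].
  by have [? ?] := uvV i; exists (u i) => //; exists (v i).
by apply: eq_bigr => i _; rewrite scale1r.
Qed.

(** Each value that the choice may return, from whatever representation of [k], equals the
    coordinate formula. This is the well-definedness of S (x) S' on the algebraic tensor product. *)
Lemma tens_opE S S' k : linear_on V S -> linear_on V S' ->
  tens_subspace tens V k -> tens_op tens V S S' k = tens_coord S S' k.
Proof.
move=> SL SL' /tens_subspaceP[m [u [v [uvV kE]]]].
rewrite /tens_op; set D := [set k' | _].
have DE k' : D k' -> k' = tens_coord S S' k.
  move=> [m' [u' [v' [uvV' -> ->]]]]; rewrite tens_coord_sum.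
  by apply: eq_bigr => i _; have [? ?] := uvV' i; rewrite tens_coord_tens.
apply: DE; apply: (@xgetPex _ 0 D).
by exists (\sum_i tens (S (u i)) (S' (v i))), m, u, v.
Qed.

Lemma linear_on_id : linear_on V (@id H).
Proof. by move=> a x y. Qed.

Lemma tens_coord_id k : tens_subspace tens V k -> tens_coord id id k = k.
Proof.
move=> /tens_subspaceP[m [u [v [uvV ->]]]]; rewrite tens_coord_sum.
apply: eq_bigr => i _; have [? ?] := uvV i.
by rewrite tens_coord_tens//; exact: linear_on_id.
Qed.

Lemma tens_subspace_lin a k k' : tens_subspace tens V k ->
  tens_subspace tens V k' -> tens_subspace tens V (a *: k + k').
Proof.
move=> [m [c [s [sV ->]]]] [m' [c' [s' [sV' ->]]]].
exists (m + m')%N, (fun i => match fintype.split i with inl j => a * c j |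
  inr j => c' j end),
  (fun i => match fintype.split i with inl j => s j | inr j => s' j end).
split=> [i|]; first by case: fintype.split.
rewrite big_split_ord /= scaler_sumr; congr (_ + _).
  by apply: eq_bigr => i _; rewrite (unsplitK (inl i)) scalerA.
by apply: eq_bigr => i _; rewrite (unsplitK (inr i)).
Qed.

Lemma tens_subspace_coord (c : 'I_n -> 'I_n -> R) :
  tens_subspace tens V (\sum_i \sum_j c i j *: tens (b i) (b j)).
Proof.
apply/tens_subspaceP; exists n, b, (fun i => \sum_j c i j *: b j); split.
  move=> i; split; first exact: (onb_mem Vb).
  by apply: (subspace_sum VS) => j; apply: (subspaceZ VS); exact: (onb_mem Vb).
by apply: eq_bigr => i _; rewrite tens_sumr; apply: eq_bigr => j _;
  rewrite tensZr.
Qed.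

(* [S (x) S] is injective when [S] is: pairing [sum_i (S u_i) (x) (S b_i)] with
   [b_r (x) v] exhibits a vector of the kernel of [S]. *)
Lemma tens_coord_inj S k : linear_on V S -> (forall v, V v -> V (S v)) ->
  (forall v, V v -> S v = 0 -> v = 0) ->
  tens_subspace tens V k -> tens_coord S S k = 0 -> k = 0.
Proof.
move=> SL SV Sinj kV Sk0.
pose a i j := dot k (tens (b i) (b j)).
have Sb i : V (S (b i)) by apply: SV; exact: (onb_mem Vb).
(* In these terms [k] is the sum of the [tens (u j) (b j)], so it suffices that every [u j]
   vanishes. *)
pose u j := \sum_i a i j *: b i.
have Vu j : V (u j).
  by apply: (subspace_sum VS) => i; apply: (subspaceZ VS); exact: (onb_mem Vb).
have E0 : \sum_j tens (S (u j)) (S (b j)) = 0.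
  rewrite -[RHS]Sk0 /tens_coord exchange_big; apply: eq_bigr => j _.
  rewrite (linear_on_sum VS SL); last first.
    by move=> i; apply: (subspaceZ VS); exact: (onb_mem Vb).
  rewrite tens_suml; apply: eq_bigr => i _.
  by rewrite (linear_onZ VS SL) ?tensZl//; exact: (onb_mem Vb).
have w0 r j : dot (S (u j)) (b r) = 0.
  pose w := \sum_j dot (S (u j)) (b r) *: b j.
  have Vw : V w.
    by apply: (subspace_sum VS) => i; apply: (subspaceZ VS);
      exact: (onb_mem Vb).
  have Sw : S w = 0.
    apply: dot_inj => v; rewrite dot0l.
    have := congr1 (dot^~ (tens (b r) v)) E0; rewrite dot0l dot_suml => <-.
    rewrite (linear_on_sum VS SL); last first.
      by move=> i; apply: (subspaceZ VS); exact: (onb_mem Vb).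
    rewrite dot_suml; apply: eq_bigr => i _.
    by rewrite (linear_onZ VS SL) ?dotZl ?(tens_dot tensH)//;
      exact: (onb_mem Vb).
  have := congr1 (dot^~ (b j)) (Sinj _ Vw Sw); rewrite dot0l dot_suml.
  rewrite (bigD1 j)//= big1 => [|i /negbTE ij]; rewrite dotZl (onb_dot Vb).
    by rewrite eqxx mulr1 addr0.
  by rewrite ij mulr0.
have u0 j : u j = 0.
  apply: Sinj => //; rewrite (onb_expand Vb (SV _ (Vu j))) big1// => i _.
  by rewrite w0 scale0r.
rewrite -(tens_coord_id kV) /tens_coord exchange_big big1// => j _.
rewrite -[RHS](tens0l (b j)) -(u0 j) tens_suml.
by apply: eq_bigr => i _; rewrite tensZl.
Qed.

End tensor_operators.

(** * Fractional powers and discrete operators *)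

Section fractional_powers.
Context {R : realType} {H : hilbertType R}.
Context {domA : set H} {A : H -> H} {e : nat -> H} {lam : nat -> R}.
Hypothesis A_gen : generator domA A e lam.

Lemma pow_series_linear r a x y :
  pow_series e lam r (a *: x + y)
  = (fun n => a *: pow_series e lam r x n + pow_series e lam r y n).
Proof.
apply/funext => n; rewrite /pow_series /series /= scaler_sumr -big_split /=.
apply: eq_bigr => i _; rewrite scalerA -scalerDl; congr (_ *: _).
by rewrite dotDl dotZl; ring.
Qed.

Lemma cvg_pow_series_linear r a x y : Hdot e lam r x -> Hdot e lam r y ->
  pow_series e lam r (a *: x + y) @ \oo
    --> a *: powA e lam r x + powA e lam r y.
Proof.
move=> xr yr; rewrite pow_series_linear.
by apply: cvgD; [apply: cvgZr|].
Qed.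

Lemma Hdot_subspace r : is_subspace (Hdot e lam r).
Proof.
split=> [|a x y xr yr]; last first.
  by apply/cvg_ex; eexists; exact: cvg_pow_series_linear.
rewrite /Hdot /=.
have -> : pow_series e lam r 0 = fun=> 0.
  apply/funext => n; rewrite /pow_series /series /= big1// => i _.
  by rewrite dot0l mulr0 scale0r.
exact: is_cvg_cst.
Qed.

Lemma powA_linear r : linear_on (Hdot e lam r) (powA e lam r).
Proof.
move=> a x y xr yr; apply: cvg_lim; first exact: norm_hausdorff.
exact: cvg_pow_series_linear.
Qed.

Lemma dot__linear r a x y z : Hdot e lam r x -> Hdot e lam r y ->
  dot_ e lam r (a *: x + y) z = a * dot_ e lam r x z + dot_ e lam r y z.
Proof. by move=> xr yr; rewrite /dot_ powA_linear// dotDl dotZl. Qed.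

Lemma dot__linearr r a x y z : Hdot e lam r x -> Hdot e lam r y ->
  dot_ e lam r z (a *: x + y) = a * dot_ e lam r z x + dot_ e lam r z y.
Proof. by move=> xr yr; rewrite /dot_ powA_linear// dotDr dotZr. Qed.

Let eo := gen_orthonormal A_gen.

Lemma dot_sum_eigen n (c : nat -> R) i :
  dot (\sum_(0 <= j < n) c j *: e j) (e i) = if (i < n)%N then c i else 0.
Proof.
rewrite dot_suml big_mkord; case: ifPn => [lin|].
  rewrite (bigD1 (Ordinal lin))//= dotZl eo eqxx mulr1 big1 ?addr0// => j ji.
  rewrite dotZl eo; case: eqP => [ej|]; last by rewrite mulr0.
  by move: ji; rewrite -(inj_eq val_inj)/= ej eqxx.
rewrite -leqNgt => ni; rewrite big1// => j _; rewrite dotZl eo.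
by rewrite (ltn_eqF (leq_trans (ltn_ord j) ni)) mulr0.
Qed.

(** Pairing with [e i] is continuous, and the partial sums of the series have a constant [i]-th
    coefficient from rank [i.+1] on. *)
Lemma dot_powA_eigen r x i : Hdot e lam r x ->
  dot (powA e lam r x) (e i) = lam i `^ (r / 2) * dot x (e i).
Proof.
move=> xr; set c := RHS.
have h1 : (fun n => dot (pow_series e lam r x n) (e i)) @ \oo
    --> dot (powA e lam r x) (e i).
  exact: (cvg_comp _ (fun y => dot y (e i)) xr (@dot_continuous R H (e i) _)).
have h2 : (fun n => dot (pow_series e lam r x n) (e i)) @ \oo --> c.
  apply: cvg_near_cst; exists i.+1 => // n /= lin.
  by rewrite /pow_series /series /= dot_sum_eigen lin.
exact: (cvg_unique _ h1 h2).
Qed.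

Let proj n x := \sum_(0 <= j < n) dot x (e j) *: e j.

Let dot_projB n x i : (i < n)%N -> dot (x - proj n x) (e i) = 0.
Proof. by move=> lin; rewrite dotBl dot_sum_eigen lin subrr. Qed.

Let dot_proj_projB n x : dot (x - proj n x) (proj n x) = 0.
Proof.
rewrite /proj dot_sumr big_mkord big1// => i _.
by rewrite dotZr dot_projB ?ltn_ord// mulr0.
Qed.

Let proj_sqr n x : `|proj n x| ^+ 2 = \sum_(0 <= j < n) dot x (e j) ^+ 2.
Proof.
rewrite -dot_norm {1}/proj dot_suml !big_mkord; apply: eq_bigr => i _.
by rewrite dotZl (dotC (e i)) dot_sum_eigen ltn_ord expr2.
Qed.

Let bessel n x : `|proj n x| ^+ 2 <= `|x| ^+ 2.
Proof.
rewrite -!dot_norm; have := dot_proj_projB n x.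
set p := proj n x; pose u := x - p; rewrite -/u => up.
have xE : x = u + p by rewrite subrK.
clearbody u; clearbody p.
have -> : dot x x = dot u u + dot p p.
  by rewrite {1 2}xE !dotDl !dotDr (dotC p u) up addr0 add0r.
by rewrite lerDr dot_ge0.
Qed.

(** Totality only provides some finite combination [z] of eigenvectors near [x]. Once [n] exceeds
    every index in [z], the residual [x - proj n x] is orthogonal to [z] and to [proj n x], so its
    squared norm is its product with [x - z]. *)
Let proj_cvg x (eps : R) : 0 < eps -> exists n, `|x - proj n x| < eps.
Proof.
move=> eps0.
have [z [/= xz [m [c [s [sE zE]]]]]] :
  ball x eps `&` Defs.span (range e) !=set0.
  apply: (gen_total A_gen); last exact: ball_open.
  by exists x; exact: ballxx.
have {}sE l : exists k, e k = s l by have [k _ <-] := sE l; exists k.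
pose k l := sval (cid (sE l)).
pose n := (\max_(l < m) k l).+1; exists n.
have zo : dot (x - proj n x) z = 0.
  rewrite zE dot_sumr big1// => l _; rewrite dotZr.
  have -> : s l = e (k l) by rewrite /k; case: cid.
  by rewrite dot_projB ?mulr0// ltnS; exact: (leq_bigmax l).
have xz' : `|x - z| < eps by move: xz; rewrite -ball_normE.
apply: le_lt_trans xz'.
have [->|d0] := eqVneq (x - proj n x) 0; first by rewrite normr0.
rewrite -(@ler_pM2l _ `|x - proj n x|) ?normr_gt0// -expr2 -dot_norm.
rewrite (dotBr x (proj n x)) dot_proj_projB -zo -(dotBr x z).
by rewrite (le_trans (ler_norm _))// cauchy_schwarz.
Qed.

(** Poincare inequality; the constant comes from the least eigenvalue [lam 0]. Coefficients are
    compared on partial sums, Bessel's inequality bounds those of [powA], and [proj_cvg] passes to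
    the limit. *)
Lemma Hdot1_norm_le x : Hdot e lam 1 x ->
  `|x| <= (Num.sqrt (lam 0%N))^-1 * norm_ e lam 1 x.
Proof.
move=> x1; set y := powA e lam 1 x.
have l0 : 0 < lam 0%N := gen_lam_gt0 A_gen 0%N.
have sl0 : 0 < Num.sqrt (lam 0%N) by rewrite sqrtr_gt0.
have projE n : `|proj n x| <= (Num.sqrt (lam 0%N))^-1 * `|y|.
  rewrite ler_pdivlMl// -(@ler_pXn2r _ 2)// ?nnegrE ?mulr_ge0//.
  rewrite exprMn sqr_sqrtr ?(ltW l0)//.
  apply: le_trans _ (bessel n y).
  rewrite !proj_sqr mulr_sumr; apply: ler_sum => i _.
  rewrite dot_powA_eigen// exprMn ler_wpM2r ?sqr_ge0//.
  have li := ltW (gen_lam_gt0 A_gen i).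
  by rewrite div1r powR12_sqrt// sqr_sqrtr// (gen_lam_incr A_gen).
apply/ler_addgt0Pr => eps eps0; have [n xn] := proj_cvg x eps0.
rewrite -[in leLHS](subrK (proj n x) x) (le_trans (ler_normD _ _))// addrC.
by rewrite lerD// ltW.
Qed.

(** The initial value is assumed Gaussian when tested against [Hdotm1]; this membership makes its
    ordinary components Gaussian too. *)
Lemma Hdotm1_dot b : Hdotm1 e lam (fun x => dot x b).
Proof.
split; first by move=> a x y _ _; rewrite dotDl dotZl.
exists ((Num.sqrt (lam 0%N))^-1 * `|b|) => x x1.
rewrite (le_trans (cauchy_schwarz _ _))// mulrAC ler_wpM2r//.
exact: Hdot1_norm_le.
Qed.

End fractional_powers.

Section discrete_operators.
Context {R : realType} {H : hilbertType R}.
Variables (V : set H) (n : nat) (b : 'I_n -> H).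
Hypotheses (VS : is_subspace V) (Vb : onb V b).

(** Riesz representation in [V], the coordinates of the representing vector being the values
    [l (b i)]. Hence the [xget] in [Pproj] does not fall back on its default for functionals linear
    on [V]. *)
Lemma PprojP (l : H -> R) : linear_on V (l : H -> R^o) ->
  V (Pproj V l) /\ forall phi, V phi -> dot (Pproj V l) phi = l phi.
Proof.
move=> lL; rewrite /Pproj; set D := [set v | _].
apply: (@xgetPex _ 0 D); exists (\sum_i l (b i) *: b i); split.
  by apply: (subspace_sum VS) => i; apply: (subspaceZ VS); exact: (onb_mem Vb).
move=> phi Vphi; rewrite (onb_linear VS Vb lL Vphi) dot_suml.
by apply: eq_bigr => i _; rewrite dotZl dotC [RHS]mulrC.
Qed.

Lemma dot_V_inj u v : V u -> V v ->
  (forall phi, V phi -> dot u phi = dot v phi) -> u = v.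
Proof.
move=> Vu Vv uv; apply/eqP; rewrite -subr_eq0; apply/eqP/dot_eq0.
by rewrite dotBl uv ?subrr//; exact: (subspaceB VS).
Qed.

Lemma Pproj_linear a (l l1 l2 : H -> R) :
  linear_on V (l1 : H -> R^o) -> linear_on V (l2 : H -> R^o) ->
  (forall phi, V phi -> l phi = a * l1 phi + l2 phi) ->
  Pproj V l = a *: Pproj V l1 + Pproj V l2.
Proof.
move=> l1L l2L lE.
have lL : linear_on V (l : H -> R^o).
  move=> c x y Vx Vy; rewrite !lE//; last exact: VS.2.
  rewrite l1L// l2L// -![_ *: _]/(_ * _); ring.
have [Vl lP] := PprojP lL; have [V1 lP1] := PprojP l1L.
have [V2 lP2] := PprojP l2L.
apply: dot_V_inj => [//||phi Vphi]; first exact: VS.2.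
by rewrite lP// lE// dotDl dotZl lP1// lP2.
Qed.

Context {e : nat -> H} {lam : nat -> R} (V1 : V `<=` Hdot e lam 1).

Let dot_1L f : linear_on V (dot_ e lam 1 f : H -> R^o).
Proof. by move=> a x y Vx Vy; rewrite dot__linearr//; exact: V1. Qed.

(** By unfolding, [neg_Ah] is [Pproj] applied to the functional [dot_ e lam 1 f], which is linear on
    [V]. *)
Lemma neg_AhP f : V (neg_Ah e lam V f) /\
  forall g, V g -> dot (neg_Ah e lam V f) g = dot_ e lam 1 f g.
Proof. exact: PprojP (dot_1L f). Qed.

Variable dt : R.
Hypothesis dt0 : 0 <= dt.

Lemma RopE f : Rop e lam V dt f = f + dt *: neg_Ah e lam V f.
Proof. by rewrite /Rop /Ah scalerN opprK. Qed.

Lemma Rop_mem f : V f -> V (Rop e lam V dt f).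
Proof.
by move=> Vf; rewrite RopE addrC; apply: VS.2 => //; exact: (neg_AhP f).1.
Qed.

Lemma Rop_linear : linear_on V (Rop e lam V dt).
Proof.
move=> a x y Vx Vy; rewrite !RopE.
have -> : neg_Ah e lam V (a *: x + y) = a *:
  neg_Ah e lam V x + neg_Ah e lam V y.
  apply: (Pproj_linear (dot_1L x) (dot_1L y)) => phi Vphi.
  by rewrite dot__linear//; exact: V1.
by rewrite !scalerDr !scalerA addrACA (mulrC dt).
Qed.

(* [- A_h] is positive semidefinite, so [<R f, f> >= |f|^2]. *)
Lemma norm_le_Rop f : V f -> `|f| <= `|Rop e lam V dt f|.
Proof.
move=> Vf; have [->|f0] := eqVneq f 0; first by rewrite normr0.
rewrite -(@ler_pM2r _ `|f|) ?normr_gt0//.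
rewrite (le_trans _ (cauchy_schwarz _ _))// (le_trans _ (ler_norm _))//.
rewrite RopE dotDl dotZl (neg_AhP f).2// dot_norm expr2 lerDl mulr_ge0//.
exact: dot_ge0.
Qed.

Lemma Rop_inj f : V f -> Rop e lam V dt f = 0 -> f = 0.
Proof.
move=> /norm_le_Rop + Rf0; rewrite Rf0 normr0.
by move=> f0; apply/eqP; rewrite -normr_le0.
Qed.

End discrete_operators.

(** * Weak expectations in finite-dimensional subspaces *)

Section weak_expectation.
Context {R : realType} {d : measure_display} {Om : measurableType d}.
Context (P : probability Om R).
Notation L1 := (Lfun P 1).
Notation L2 := (Lfun P 2).

Section one_space.
Context {H : hilbertType R}.
Implicit Types Z : Om -> H.

(** Unlike [expect], this relation records the integrability of every component, which is what
    allows expectations to be added. *)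
Definition is_expect Z (m : H) : Prop := forall phi,
  (fun w => dot (Z w) phi) \in L1 /\
  ('E_P[fun w => dot (Z w) phi] = (dot m phi)%:E)%E.

Lemma eq_is_expect Z Z' m : Z =1 Z' -> is_expect Z m -> is_expect Z' m.
Proof. by move=> /funext ->. Qed.

Lemma is_expect_expect Z m : is_expect Z m -> expect P Z = m.
Proof.
move=> Zm; apply: xget_unique => [phi|m' m'P]; first by rewrite (Zm phi).2.
by apply: dot_inj => phi; apply: EFin_inj; rewrite m'P (Zm phi).2.
Qed.

(** The source of each recursion: an identity of the scheme holds almost everywhere, and the
    expectations of its two sides are computed separately. *)
Lemma ae_is_expect_eq Z Z' m m' : is_expect Z m -> is_expect Z' m' ->
  {ae P, forall w, Z w = Z' w} -> m = m'.
Proof.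
move=> Zm Zm' ZZ'; apply: dot_inj => phi; apply: EFin_inj.
rewrite -(Zm phi).2 -(Zm' phi).2; apply: ae_eq_expectation.
- exact: Lfun_measurable (Zm phi).1.
- exact: Lfun_measurable (Zm' phi).1.
- by apply: filterS ZZ' => w ->.
Qed.

Lemma ae_is_expect Z Z' m :
  (forall phi, measurable_fun setT (fun w => dot (Z' w) phi)) ->
  {ae P, forall w, Z w = Z' w} -> is_expect Z m -> is_expect Z' m.
Proof.
move=> mZ' ZZ' Zm phi; have [Z1 <-] := Zm phi.
have ZZ'phi : {ae P, forall w, dot (Z w) phi = dot (Z' w) phi}.
  by apply: filterS ZZ' => w ->.
split; first exact: ae_eq_Lfun1 ZZ'phi Z1.
apply/esym/ae_eq_expectation => //; exact: Lfun_measurable Z1.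
Qed.

Lemma is_expect_lin a Z Z' m m' : is_expect Z m -> is_expect Z' m' ->
  is_expect (fun w => a *: Z w + Z' w) (a *: m + m').
Proof.
move=> Zm Zm' phi; have [Z1 ZE] := Zm phi; have [Z1' ZE'] := Zm' phi.
rewrite (_ : (fun _ => _) = (fun w => a * dot (Z w) phi + dot (Z' w) phi)).
  by rewrite expectation_lin// ZE ZE' dotDl dotZl; split=> //; exact: Lfun_lin.
by apply/funext => w; rewrite dotDl dotZl.
Qed.

Lemma is_expectD Z Z' m m' : is_expect Z m -> is_expect Z' m' ->
  is_expect (fun w => Z w + Z' w) (m + m').
Proof.
move=> Zm Zm'; have := is_expect_lin 1 Zm Zm'; rewrite scale1r => h.
by apply: eq_is_expect h => w; rewrite /= scale1r.
Qed.

Lemma is_expect_scal (x : Om -> R) (r : R) (c : H) : x \in L1 ->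
  ('E_P[x] = r%:E)%E -> is_expect (fun w => x w *: c) (r *: c).
Proof.
move=> x1 xE phi.
have x0 : (cst 0 : Om -> R) \in L1 by exact: Lfun_cst.
rewrite (_ : (fun _ => _) = (fun w => dot c phi * x w + cst 0 w)).
  split; first exact: Lfun_lin.
  by rewrite expectation_lin// xE expectation_cst adde0 dotZl mulrC.
by apply/funext => w; rewrite dotZl addr0 mulrC.
Qed.

Lemma is_expect_cst c : is_expect (fun=> c) c.
Proof.
have := @is_expect_scal (cst 1) 1 c (Lfun_cst _ _ _) (expectation_cst _ _).
by rewrite scale1r => h; apply: eq_is_expect h => w /=; rewrite ?scale1r.
Qed.

Lemma is_expect_sum (I : finType) (F : I -> Om -> H) (m : I -> H) :
  (forall i, is_expect (F i) (m i)) ->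
  is_expect (fun w => \sum_i F i w) (\sum_i m i).
Proof.
move=> Fm.
suff h (r : seq I) : is_expect (fun w => \sum_(i <- r) F i w) (\sum_(i <- r)
  m i).
  exact: h.
elim: r => [|i r IH].
  by rewrite big_nil; apply: eq_is_expect (is_expect_cst 0) => w;
    rewrite big_nil.
rewrite big_cons; apply: eq_is_expect (is_expectD (Fm i) IH) => w.
by rewrite big_cons.
Qed.

End one_space.

Lemma rand_var_measurable_dot {H : hilbertType R} (Z : Om -> H) phi :
  rand_var Z -> measurable_fun setT (fun w => dot (Z w) phi).
Proof.
move=> mZ; apply: (measurability _ (RGenOInfty.measurableE R)).
move=> _ [_ [a ->] <-]; rewrite setTI.
apply: (mZ [set x | dot x phi \in `]a, +oo[]).
apply: (@open_comp _ _ (fun x => dot x phi) `]a, +oo[%classic).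
  by move=> x _; exact: dot_continuous.
exact: interval_open.
Qed.

Section finite_dimensional.
Context {H : hilbertType R} (V : set H) (n : nat) (b : 'I_n -> H).
Hypotheses (VS : is_subspace V) (Vb : onb V b).
Implicit Types Z : Om -> H.

(** [S] is assumed linear on [V] only, so it is moved past the expectation through the finite
    expansion in [b]. *)
Lemma is_expect_linear {K : hilbertType R} (S : H -> K) Z m :
  linear_on V S -> (forall w, V (Z w)) -> V m ->
  is_expect Z m -> is_expect (S \o Z) (S m).
Proof.
move=> SL VZ Vm Zm; rewrite (onb_linear VS Vb SL Vm).
rewrite (_ : S \o Z = fun w => \sum_i dot (Z w) (b i) *: S (b i)).
  apply: is_expect_sum => i; have [Z1 ZE] := Zm (b i).
  exact: is_expect_scal.
by apply/funext => w; exact: (onb_linear VS Vb SL (VZ w)).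
Qed.

(** Square integrability tested on components, a form stable under sums and linear maps. For weakly
    measurable [V]-valued variables it amounts to a finite second moment of the norm, by
    [Lfun2_in_norm_sqr] and [Lfun2_in_of_norm_sqr]. *)
Definition Lfun2_in Z : Prop :=
  (forall w, V (Z w)) /\ forall phi, (fun w => dot (Z w) phi) \in L2.

Lemma eq_Lfun2_in Z Z' : Z =1 Z' -> Lfun2_in Z -> Lfun2_in Z'.
Proof. by move=> /funext ->. Qed.

Lemma norm_sqr_onb v : V v -> `|v| ^+ 2 = \sum_i dot v (b i) ^+ 2.
Proof.
move=> Vv; rewrite -dot_norm {1}(onb_expand Vb Vv) dot_suml.
by apply: eq_bigr => i _; rewrite dotZl dotC (dotC (b i)) expr2.
Qed.

Lemma measurable_norm_sqr Z : (forall w, V (Z w)) ->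
  (forall phi, measurable_fun setT (fun w => dot (Z w) phi)) ->
  measurable_fun setT (fun w => `|Z w| ^+ 2).
Proof.
move=> VZ mZ; under eq_fun do rewrite norm_sqr_onb//.
by apply: measurable_sum => i; exact: measurable_funX.
Qed.

Lemma Lfun2_in_norm_sqr Z : Lfun2_in Z ->
  ('E_P[fun w => (`|Z w| ^+ 2)%R] < +oo)%E.
Proof.
move=> [VZ Z2].
(* The scalar [|Z|^2] is the pairing of this vector with the sum of the [b i]; finiteness of its
   expectation is then read off from [is_expect_sum]. *)
have : is_expect (H := H) (fun w => \sum_i (dot (Z w) (b i) ^+ 2) *: b i)
    (\sum_i fine 'E_P[fun w => (dot (Z w) (b i) ^+ 2)%R]%E *: b i).
  apply: is_expect_sum => i; apply: is_expect_scal.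
    exact: (Lfun2_mul (Z2 (b i)) (Z2 (b i))).
  by rewrite fineK// expectation_fin_num//;
    exact: (Lfun2_mul (Z2 (b i)) (Z2 (b i))).
move=> /(_ (\sum_i b i))[_ E].
rewrite (_ : (fun _ => _) = (fun w => dot (\sum_i dot (Z w) (b i) ^+ 2 *:
  b i) (\sum_i b i))).
  by rewrite E ltry.
apply/funext => w; rewrite norm_sqr_onb// dot_suml; apply: eq_bigr => i _.
rewrite dotZl dot_sumr (bigD1 i)//= (onb_dot Vb) eqxx big1 ?addr0 ?mulr1// => j.
by rewrite (onb_dot Vb) eq_sym => /negbTE ->.
Qed.

Lemma Lfun2_in_sq_integrable Z : rand_var Z -> Lfun2_in Z -> sq_integrable P Z.
Proof. by move=> mZ Z2; split=> //; exact: Lfun2_in_norm_sqr. Qed.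

Lemma expectation_dot_sqr_le Z phi : (forall w, V (Z w)) ->
  (forall psi, measurable_fun setT (fun w => dot (Z w) psi)) ->
  ('E_P[fun w => (dot (Z w) phi ^+ 2)%R]
    <= (`|phi| ^+ 2)%:E * 'E_P[fun w => (`|Z w| ^+ 2)%R])%E.
Proof.
move=> VZ mZ; rewrite unlock -ge0_integralZl//; last first.
  by apply/measurable_EFinP; exact: measurable_norm_sqr.
apply: ge0_le_integral => //.
- by move=> w _; rewrite lee_fin sqr_ge0.
- by apply/measurable_EFinP; exact: measurable_funX.
- apply: emeasurable_funM => //.
  by apply/measurable_EFinP; exact: measurable_norm_sqr.
move=> w _; rewrite -EFinM lee_fin -exprMn -real_normK ?num_real//.
by rewrite lerXn2r ?nnegrE ?mulr_ge0// mulrC cauchy_schwarz.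
Qed.

Lemma Lfun2_in_of_norm_sqr Z : (forall w, V (Z w)) ->
  (forall phi, measurable_fun setT (fun w => dot (Z w) phi)) ->
  ('E_P[fun w => (`|Z w| ^+ 2)%R] < +oo)%E -> Lfun2_in Z.
Proof.
move=> VZ mZ Z2; split=> // phi; apply/Lfun2P; split=> //.
apply: (le_lt_trans (expectation_dot_sqr_le phi VZ mZ)).
by rewrite lte_mul_pinfty// lee_fin sqr_ge0.
Qed.

(** Serves the implicit step, where the scheme gives R X_(j+1) and the norm of X_(j+1) is at most
    that of R X_(j+1). *)
Lemma Lfun2_in_dominated Z Z' : (forall w, V (Z w)) ->
  (forall phi, measurable_fun setT (fun w => dot (Z w) phi)) ->
  {ae P, forall w, `|Z w| <= `|Z' w|} -> Lfun2_in Z' -> Lfun2_in Z.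
Proof.
move=> VZ mZ ZZ' Z2'; apply: Lfun2_in_of_norm_sqr => //.
apply: le_lt_trans (Lfun2_in_norm_sqr Z2').
have [VZ' mZ'] := Z2'.
apply: expectation_le => [|||w|].
- exact: measurable_norm_sqr.
- by apply: measurable_norm_sqr => // phi; exact: Lfun_measurable (mZ' phi).
- by move=> w; rewrite sqr_ge0.
- by rewrite sqr_ge0.
- by apply: filterS ZZ' => w h; rewrite lerXn2r ?nnegrE.
Qed.

Lemma ae_Lfun2_in Z Z' : (forall w, V (Z' w)) ->
  (forall phi, measurable_fun setT (fun w => dot (Z' w) phi)) ->
  {ae P, forall w, Z w = Z' w} -> Lfun2_in Z -> Lfun2_in Z'.
Proof.
move=> VZ' mZ' ZZ' Z2; apply: (@Lfun2_in_dominated _ Z) => //.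
by apply: filterS ZZ' => w ->.
Qed.

Lemma Lfun2_in_lin a Z Z' : Lfun2_in Z -> Lfun2_in Z' ->
  Lfun2_in (fun w => a *: Z w + Z' w).
Proof.
move=> [VZ Z2] [VZ' Z2']; split=> [w|phi]; first exact: VS.2.
rewrite (_ : (fun _ => _) = (fun w => a * dot (Z w) phi + dot (Z' w) phi)).
  exact: Lfun2_lin.
by apply/funext => w; rewrite dotDl dotZl.
Qed.

Lemma Lfun2_inD Z Z' : Lfun2_in Z -> Lfun2_in Z' ->
  Lfun2_in (fun w => Z w + Z' w).
Proof.
move=> Z2 Z2'; have h := Lfun2_in_lin 1 Z2 Z2'.
by apply: eq_Lfun2_in h => w; rewrite scale1r.
Qed.

Lemma Lfun2_in_cst c : V c -> Lfun2_in (fun=> c).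
Proof. by move=> Vc; split=> // phi; exact: Lfun_cst. Qed.

Lemma Lfun2_in_scal (x : Om -> R) c : V c -> x \in L2 ->
  Lfun2_in (fun w => x w *: c).
Proof.
move=> Vc x2; split=> [w|phi]; first exact: (subspaceZ VS).
rewrite (_ : (fun _ => _) = (fun w => dot c phi * x w + cst 0 w)).
  by apply: Lfun2_lin => //; exact: Lfun_cst.
by apply/funext => w; rewrite dotZl addr0 mulrC.
Qed.

Lemma Lfun2_in_sum (I : finType) (F : I -> Om -> H) :
  (forall i, Lfun2_in (F i)) -> Lfun2_in (fun w => \sum_i F i w).
Proof.
move=> Fm.
suff h (r : seq I) : Lfun2_in (fun w => \sum_(i <- r) F i w) by exact: h.
elim: r => [|i r IH].
  by apply: eq_Lfun2_in (Lfun2_in_cst VS.1) => w; rewrite big_nil.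
by apply: eq_Lfun2_in (Lfun2_inD (Fm i) IH) => w; rewrite big_cons.
Qed.

Lemma Lfun2_in_linear (S : H -> H) Z : linear_on V S ->
  (forall v, V v -> V (S v)) -> Lfun2_in Z -> Lfun2_in (S \o Z).
Proof.
move=> SL SV [VZ Z2].
rewrite (_ : S \o Z = fun w => \sum_i dot (Z w) (b i) *: S (b i)).
  apply: Lfun2_in_sum => i; apply: Lfun2_in_scal => //.
  by apply: SV; exact: (onb_mem Vb).
by apply/funext => w; exact: (onb_linear VS Vb SL (VZ w)).
Qed.

Lemma Lfun2_in_expectM (x : Om -> R) Z : x \in L2 -> Lfun2_in Z ->
  exists2 m, V m & is_expect (fun w => x w *: Z w) m.
Proof.
move=> x2 [VZ Z2].
exists (\sum_i fine 'E_P[fun w => (x w * dot (Z w) (b i))%R]%E *: b i).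
  by apply: (subspace_sum VS) => i; apply: (subspaceZ VS); exact: (onb_mem Vb).
rewrite (_ : (fun _ => _) = fun w => \sum_i (x w * dot (Z w) (b i)) *: b i).
  apply: is_expect_sum => i; apply: is_expect_scal; first exact: Lfun2_mul.
  by rewrite fineK// expectation_fin_num//; exact: Lfun2_mul.
apply/funext => w; rewrite {1}(onb_expand Vb (VZ w)) scaler_sumr.
by apply: eq_bigr => i _; rewrite scalerA.
Qed.

Lemma Lfun2_in_expect Z : Lfun2_in Z -> exists2 m, V m & is_expect Z m.
Proof.
move=> /(Lfun2_in_expectM (Lfun_cst P 1 2))[m Vm Zm]; exists m => //.
by apply: eq_is_expect Zm => w; rewrite /= scale1r.
Qed.

Context {K : hilbertType R} (tens : H -> H -> K).
Hypothesis tensH : hilbert_tensor tens.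

Lemma is_expect_tens Z Z' (c : 'I_n -> 'I_n -> R) :
  Lfun2_in Z -> Lfun2_in Z' ->
  (forall i j, 'E_P[fun w => (dot (Z w) (b i) * dot (Z' w) (b j))%R] = (c i
    j)%:E)%E ->
  is_expect (fun w => tens (Z w) (Z' w))
    (\sum_i \sum_j c i j *: tens (b i) (b j)).
Proof.
move=> [VZ Z2] [VZ' Z2'] cE.
rewrite (_ : (fun _ => _) = fun w => \sum_i \sum_j
    (dot (Z w) (b i) * dot (Z' w) (b j)) *: tens (b i) (b j)).
  apply: is_expect_sum => i; apply: is_expect_sum => j.
  by apply: is_expect_scal => //; exact: Lfun2_mul.
apply/funext => w; rewrite {1}(onb_expand Vb (VZ w)) (tens_suml tensH).
apply: eq_bigr => i _; rewrite {1}(onb_expand Vb (VZ' w)) (tens_sumr tensH).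
by apply: eq_bigr => j _; rewrite (tensZl tensH) (tensZr tensH) scalerA.
Qed.

Lemma is_expect_tens0 Z Z' : Lfun2_in Z -> Lfun2_in Z' ->
  (forall i j, 'E_P[fun w => (dot (Z w) (b i) * dot (Z' w) (b j))%R] = 0)%E ->
  is_expect (fun w => tens (Z w) (Z' w)) 0.
Proof.
move=> Z2 Z2' E0; have := @is_expect_tens Z Z' (fun _ _ => 0) Z2 Z2' E0.
by rewrite big1// => i _; rewrite big1// => j _; rewrite scale0r.
Qed.

Lemma Lfun2_in_tens Z : Lfun2_in Z ->
  exists2 S, tens_subspace tens V S & is_expect (fun w => tens (Z w) (Z w)) S.
Proof.
move=> Z2; eexists; last first.
  apply: (@is_expect_tens _ _ (fun i j =>
    fine 'E_P[fun w => (dot (Z w) (b i) * dot (Z w) (b j))%R]%E)) => // i j.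
  by rewrite fineK// expectation_fin_num//; apply: Lfun2_mul; exact: Z2.2.
exact: (tens_subspace_coord tensH VS Vb).
Qed.

(** In the form [tens_coord] the operator only involves pairings with [tens (b i) (b j)], and the
    weak expectation of [tens (Z w) (Z w)] controls exactly such pairings. *)
Lemma is_expect_tens_op (S : H -> H) Z k : linear_on V S ->
  (forall w, V (Z w)) -> tens_subspace tens V k ->
  is_expect (fun w => tens (Z w) (Z w)) k ->
  is_expect (fun w => tens (S (Z w)) (S (Z w))) (tens_op tens V S S k).
Proof.
move=> SL VZ Vk Zk; rewrite (tens_opE tensH VS Vb SL SL Vk).
rewrite (_ : (fun _ => _) = fun w => tens_coord tens b S S (tens (Z w) (Z w))).
  apply: is_expect_sum => i; apply: is_expect_sum => j.
  by have [Z1 ZE] := Zk (tens (b i) (b j)); exact: is_expect_scal.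
by apply/funext => w; rewrite (tens_coord_tens tensH VS Vb SL SL).
Qed.

End finite_dimensional.

End weak_expectation.

(** * Increments of the Wiener process and Ito integrals *)

Definition increment {R : realType} {Om H : Type} (W : R -> H -> Om -> R)
    (a b : R) (u : H) (w : Om) : R := W b u w - W a u w.

Section noise.
Context {R : realType} {d : measure_display} {Om : measurableType d}.
Context {P : probability Om R} {H : hilbertType R}.
Context {T : R} {Ft : R -> set (set Om)} {Q : H -> H} {W : R -> H -> Om -> R}.
Hypotheses (Ft_usual : usual_filtration P T Ft) (Q_psd : bounded_psd Q).
Hypothesis W_wiener : cylindrical_wiener P T Ft Q W.
Notation L1 := (Lfun P 1).
Notation L2 := (Lfun P 2).
Implicit Types (s t a b : R) (u v : H).

Local Notation incr := (increment W).

Lemma sub_measurable_fun t (Y : Om -> R) : 0 <= t <= T ->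
  sub_measurable (Ft t) Y -> measurable_fun setT Y.
Proof.
move=> tT YF _ B mB; rewrite setTI; apply: (filt_sigma Ft_usual tT).2.
exact: YF.
Qed.

Let var_ge0 a b u : a <= b -> 0 <= (b - a) * dot (Q u) u.
Proof. by move=> ab; have [_ _ _ Q0] := Q_psd; rewrite mulr_ge0 ?subr_ge0. Qed.

Lemma incr_Lfun2 a b u : 0 <= a -> a <= b -> b <= T -> incr a b u \in L2.
Proof.
move=> a0 ab bT; apply: normal_law_Lfun2 (var_ge0 u ab).
exact: (cw_normal W_wiener u a0 ab bT).
Qed.

Lemma incr_expectation0 a b u : 0 <= a -> a <= b -> b <= T ->
  ('E_P[incr a b u] = 0)%E.
Proof.
move=> a0 ab bT; apply: normal_law_expectation0 (var_ge0 u ab) _ => //.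
exact: (cw_normal W_wiener u a0 ab bT).
Qed.

(** Laws are prescribed for increments only; since [W 0 u] vanishes almost surely, [W t u] is the
    increment from time [0]. *)
Lemma wiener_Lfun2 t u : 0 <= t <= T -> W t u \in L2.
Proof.
move=> /andP[t0 tT]; apply: (@ae_eq_Lfun2 _ _ _ _ (incr 0 t u)).
- apply: (@sub_measurable_fun t); first by rewrite t0.
  by apply: (cw_adapted W_wiener); rewrite t0.
- by apply: filterS (cw_zero W_wiener u) => w; rewrite /increment => ->;
    rewrite subr0.
- exact: incr_Lfun2.
Qed.

(** Monotonicity of the filtration carries [Y] from [Ft s] to [Ft a], and the increment after [a] is
    independent of [Ft a] and centred. *)
Lemma adapted_incr_uncorrelated s a b u (Y : Om -> R) :
  0 <= s -> s <= a -> a <= b -> b <= T ->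
  sub_measurable (Ft s) Y -> Y \in L2 ->
  ('E_P[fun w => (Y w * incr a b u w)%R] = 0)%E.
Proof.
move=> s0 sa ab bT YF Y2.
have a0 : 0 <= a := le_trans s0 sa; have aT := le_trans ab bT.
have a0T : 0 <= a <= T by rewrite a0.
apply: (@indep_expectation0 _ _ _ P (Ft a)) => //.
- by move=> B mB; apply: (filt_incr Ft_usual s0 sa aT); exact: YF.
- exact: (cw_indep W_wiener).
- exact: incr_Lfun2.
- exact: incr_expectation0.
Qed.

(** The earlier increment is split into [W t u] and [W s u], each adapted by assumption, so
    measurability of their difference for [Ft t] is never at issue. *)
Lemma incr_uncorrelated s t a b u v :
  0 <= s -> s <= t -> t <= a -> a <= b -> b <= T ->
  ('E_P[fun w => (incr s t u w * incr a b v w)%R] = 0)%E.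
Proof.
move=> s0 st ta ab bT.
have t0 : 0 <= t := le_trans s0 st.
have tT : t <= T := le_trans ta (le_trans ab bT).
have sT : s <= T := le_trans st tT.
have s0T : 0 <= s <= T by rewrite s0.
have t0T : 0 <= t <= T by rewrite t0.
have D2 : incr a b v \in L2 by apply: incr_Lfun2 => //; exact: le_trans ta.
have Ws2 := wiener_Lfun2 u s0T; have Wt2 := wiener_Lfun2 u t0T.
rewrite (_ : (fun _ => _) =
  fun w => (-1) * (W s u w * incr a b v w) + W t u w * incr a b v w).
  rewrite expectation_lin ?Lfun2_mul//.
  have At := cw_adapted W_wiener u t0T; have As := cw_adapted W_wiener u s0T.
  rewrite (adapted_incr_uncorrelated v t0 ta ab bT At Wt2).
  rewrite (adapted_incr_uncorrelated v s0 (le_trans st ta) ab bT As Ws2).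
  by rewrite mule0 add0e.
by apply/funext => w; rewrite /increment; ring.
Qed.

Section ito.
Variables (V : set H) (n : nat) (e : 'I_n -> H).
Hypotheses (VS : is_subspace V) (Ve : onb V e).
Variables (s t : R) (B : H -> H) (Y : Om -> H).
Hypotheses (s0 : 0 <= s) (st : s <= t) (tT : t <= T).
Hypothesis BY : ito_integral P W Q V s t B Y.

Let approx (m : nat) (u v : nat -> H) (w : Om) : H :=
  \sum_(i < m) (W t (u i) w - W s (u i) w) *: v i.

Let approx_Lfun2 m (u v : nat -> H) : (forall i, V (v i)) ->
  Lfun2_in P V (approx m u v).
Proof.
move=> Vv; apply: (Lfun2_in_sum VS) => i; apply: (Lfun2_in_scal VS) => //.
exact: incr_Lfun2.
Qed.

Let diff_measurable m (u v : nat -> H) phi : (forall i, V (v i)) ->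
  measurable_fun setT (fun w => dot (Y w - approx m u v w) phi).
Proof.
move=> Vv; have [mY _ _] := BY; under eq_fun do rewrite dotBl.
apply: measurable_funB; first exact: rand_var_measurable_dot.
exact: Lfun_measurable ((approx_Lfun2 m u Vv).2 phi).
Qed.

(** Some finite rank integral is within L^2-distance [1] of [Y]; [Y] is the sum of that integral and
    of the square integrable difference. *)
Lemma ito_Lfun2_in : Lfun2_in P V Y.
Proof.
have [mY VY [m [u [v [Vv _ cY]]]]] := BY.
have [k Yk] := cvge0_near_lt ltr01 cY.
have A2 := approx_Lfun2 (m k) (u k) (Vv k).
have D2 : Lfun2_in P V (fun w => Y w - approx (m k) (u k) (v k) w).
  apply: (Lfun2_in_of_norm_sqr Ve).
  - by move=> w; apply: (subspaceB VS) => //; exact: A2.1.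
  - by move=> phi; exact: diff_measurable.
  - exact: lt_trans Yk (ltry _).
by apply: eq_Lfun2_in (Lfun2_inD VS D2 A2) => w; rewrite subrK.
Qed.

Lemma ito_uncorrelated (x : Om -> R) phi : x \in L2 ->
  (forall u, 'E_P[fun w => (incr s t u w * x w)%R] = 0)%E ->
  ('E_P[fun w => (dot (Y w) phi * x w)%R] = 0)%E.
Proof.
move=> x2 xW; have Y2 := ito_Lfun2_in.
have [mY VY [m [u [v [Vv _ cY]]]]] := BY.
have A2 k := approx_Lfun2 (m k) (u k) (Vv k).
apply: (Lfun2_cvg_expectation0
  (Y_ := fun k w => dot (approx (m k) (u k) (v k) w) phi)) => //.
- exact: Y2.2.
- by move=> k; exact: (A2 k).2.
(* Convergence of the component along [phi] follows from convergence in norm by Cauchy-Schwarz, with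
   factor [|phi|^2]. *)
- pose c := (`|phi| ^+ 2)%:E.
  have c0 : (c * 'E_P[fun w =>
      (`|Y w - approx (m k) (u k) (v k) w| ^+ 2)%R])%E @[k --> \oo] --> 0%E.
    by rewrite -(mule0 c); apply: cvgeZl.
  apply: (squeeze_cvge _ (cvg_cst 0%E) c0).
  near=> k; apply/andP; split.
    by apply: expectation_ge0 => w; rewrite sqr_ge0.
  rewrite (_ : 'E_P[_] = 'E_P[fun w =>
      (dot (Y w - approx (m k) (u k) (v k) w) phi ^+ 2)%R])%E; last first.
    by congr expectation; apply/funext => w; rewrite dotBl.
  apply: (expectation_dot_sqr_le P Ve
    (Z := fun w => Y w - approx (m k) (u k) (v k) w)).
    by move=> w; apply: (subspaceB VS) => //; exact: (A2 k).1.
  by move=> psi; exact: diff_measurable.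
- move=> k.
  have h : is_expect P (fun w => \sum_(i < m k) (incr s t (u k i) w * x w) *:
    v k i) (\sum_(i < m k) 0 *: v k i).
    apply: is_expect_sum => i; apply: is_expect_scal; last exact: xW.
    by apply: Lfun2_mul => //; exact: incr_Lfun2.
  have [_] := h phi; rewrite big1 ?dot0l; last by move=> i _; rewrite scale0r.
  move=> hE; apply: etrans hE; congr expectation; apply/funext => w.
  rewrite /approx !dot_suml mulr_suml; apply: eq_bigr => i _.
  by rewrite !dotZl mulrAC.
Unshelve. all: by end_near. Qed.

(** A vanishing mean is orthogonality to the constant variable [1]. *)
Lemma ito_expectation0 : is_expect P Y 0.
Proof.
move=> phi; have Y2 := ito_Lfun2_in.
split; first exact: Lfun2_Lfun1 (Y2.2 phi).
rewrite dot0l; have c2 : (cst 1 : Om -> R) \in L2 by exact: Lfun_cst.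
apply: etrans (ito_uncorrelated phi c2 _).
  by congr expectation; apply/funext => w; rewrite mulr1.
move=> u; apply: etrans (incr_expectation0 u s0 st tT).
by congr expectation; apply/funext => w; rewrite mulr1.
Qed.

End ito.

(** * The Gaussian initial value *)

Section initial_value.
Context {e : nat -> H} {lam : nat -> R} {domA : set H} {A : H -> H}.
Hypothesis A_gen : generator domA A e lam.
Variable x0 : Om -> H.
Hypothesis x0_gauss : gaussian_Hdot1 P e lam (Ft 0) x0.

Lemma initial_Lfun2 phi : (fun w => dot (x0 w) phi) \in L2.
Proof.
have [_ _ g] := x0_gauss; apply: gaussian_Lfun2.
exact: (g (fun x => dot x phi) (Hdotm1_dot A_gen phi)).
Qed.

(** Measurability of [x0] is given for open sets of the finer [Hdot 1] topology. By the Poincare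
    inequality half-spaces are open there, and they generate the events of a component. *)
Lemma initial_adapted phi : 0 <= T ->
  sub_measurable (Ft 0) (fun w => dot (x0 w) phi).
Proof.
move=> T0; have [x01 x0F _] := x0_gauss.
have FS : sigma_algebra setT (Ft 0).
  by apply: (filt_sigma Ft_usual _).1; rewrite lexx.
(* Turning the family [Ft 0] into a measurable structure on [Om] reduces the claim to preimages of
   half-lines. *)
suff mg : measurable_fun setT
    ((fun w => dot (x0 w) phi) : g_sigma_algebraType (Ft 0) -> R).
  move=> B mB; have := mg measurableT B mB.
  rewrite setTI => mgB.
  suff : <<s Ft 0 >> ((fun w => dot (x0 w) phi) @^-1` B)
    by rewrite sigma_algebra_id.
  exact: mgB.
apply: (measurability _ (RGenOInfty.measurableE R)).
move=> _ [_ [a ->] <-]; rewrite setTI; apply: sub_sigma_algebra.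
rewrite (_ : _ @^-1` _ = x0 @^-1` [set x | Hdot e lam 1 x /\ a < dot x phi]).
  apply: x0F; split=> [x []//|x [x1 ax]].
  (* A Lipschitz constant of the pairing with [phi] in the norm of [Hdot 1]; the [+ 1] keeps it
     positive when [phi] is zero. *)
  pose c := (Num.sqrt (lam 0%N))^-1 * (`|phi| + 1).
  have c0 : 0 < c.
    by rewrite mulr_gt0 ?invr_gt0 ?sqrtr_gt0 ?(gen_lam_gt0 A_gen)// ltr_wpDl.
  exists ((dot x phi - a) / c); first by rewrite divr_gt0 ?subr_gt0.
  move=> y y1 yx; split=> //.
  have yx1 : Hdot e lam 1 (y - x) by exact: (subspaceB (Hdot_subspace _)).
  have h : `|dot (y - x) phi| <= c * norm_ e lam 1 (y - x).
    rewrite (le_trans (cauchy_schwarz _ _))// mulrAC mulrC.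
    rewrite mulrC ler_pM// ?(Hdot1_norm_le A_gen)// lerDl//.
  have h2 : `|dot (y - x) phi| < dot x phi - a.
    by rewrite (le_lt_trans h)// mulrC -ltr_pdivlMr.
  by move: h2; rewrite dotBl ltr_norml => /andP[]; lra.
apply/seteqP; split=> w /=; rewrite in_itv/= andbT; first by split.
by case.
Qed.

End initial_value.

End noise.

(** * The drift-implicit Euler scheme *)

Section euler_operators.
Context {R : realType} {H : hilbertType R} {e : nat -> H} {lam : nat -> R}.
Variables (V : set H) (n : nat) (b : 'I_n -> H).
Hypotheses (VS : is_subspace V) (Vb : onb V b) (V1 : V `<=` Hdot e lam 1).
Context {T : R} {F F1 : R -> H -> H -> R} {F2 : R -> H -> R}.
Hypothesis F_drift : drift e lam T F F1 F2.
Variables (dt : R) (j : nat).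
Hypothesis jT : 0 <= j%:R * dt <= T.

Let F1L f : linear_on V (F1 (j%:R * dt) f : H -> R^o).
Proof.
move=> a x y Vx Vy; have [h _] := drift_F1 F_drift f jT.
by rewrite h//; exact: V1.
Qed.

Let F2L : linear_on V (F2 (j%:R * dt) : H -> R^o).
Proof.
move=> a x y Vx Vy; have [h _] := drift_F2 F_drift jT.
by rewrite h//; exact: V1.
Qed.

Lemma F1op_mem f : V f -> V (F1op V dt F1 j f).
Proof.
move=> Vf; rewrite /F1op addrC; apply: VS.2 => //.
exact: (PprojP VS Vb (F1L f)).1.
Qed.

Lemma F1op_linear : linear_on V (F1op V dt F1 j).
Proof.
move=> a x y Vx Vy; rewrite /F1op.
have -> : Pproj V (F1 (j%:R * dt) (a *: x + y)) =
    a *: Pproj V (F1 (j%:R * dt) x) + Pproj V (F1 (j%:R * dt) y).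
  apply: (Pproj_linear VS Vb (F1L x) (F1L y)) => phi Vphi.
  by rewrite (drift_F1_linear F_drift)//; exact: V1.
by rewrite !scalerDr !scalerA addrACA (mulrC dt).
Qed.

Lemma F2op_mem : V (F2op V dt F2 j).
Proof. by apply: (subspaceZ VS); exact: (PprojP VS Vb F2L).1. Qed.

Lemma euler_step_Rop x y z :
  y - x = dt *: (Ah e lam V y + Pproj V (F (j%:R * dt) x)) + z ->
  Rop e lam V dt y = F1op V dt F1 j x + F2op V dt F2 j + z.
Proof.
have -> : Pproj V (F (j%:R * dt) x) =
    Pproj V (F1 (j%:R * dt) x) + Pproj V (F2 (j%:R * dt)).
  rewrite -[X in X + _]scale1r.
  apply: (Pproj_linear VS Vb (F1L x) F2L) => phi Vphi.
  by rewrite mul1r (drift_affine F_drift)//; exact: V1.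
move=> /eqP; rewrite subr_eq => /eqP yE; rewrite /Rop /F1op /F2op {1}yE.
rewrite !scalerDr; apply/eqP; rewrite subr_eq; apply/eqP.
rewrite [RHS]addrC -!addrA; congr (_ + _).
by rewrite [RHS]addrC -!addrA.
Qed.

End euler_operators.

Theorem theorem3p1 (R : realType)
  (H : hilbertType R) (H_separable : separable_space H)
  (domA : set H) (A : H -> H) (e : nat -> H) (lam : nat -> R)
  (A_gen : generator domA A e lam)
  (T : R) (T_gt0 : 0 < T)
  (d : measure_display) (Om : measurableType d) (P : probability Om R)
  (Ft : R -> set (set Om)) (Ft_usual : usual_filtration P T Ft)
  (Q : H -> H) (Q_psd : bounded_psd Q)
  (W : R -> H -> Om -> R) (W_wiener : cylindrical_wiener P T Ft Q W)
  (G : R -> H -> H) (G_diff : diffusion T Q G)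
  (F F1 : R -> H -> H -> R) (F2 : R -> H -> R)
  (F_drift : drift e lam T F F1 F2)
  (x0 : Om -> H) (x0_gauss : gaussian_Hdot1 P e lam (Ft 0) x0)
  (V : R -> set H) (V_disc : discretization e lam V)
  (HH : hilbertType R) (tens : H -> H -> HH) (tens_HH : hilbert_tensor tens)
  (h : R) (h_range : 0 < h <= 1)
  (dt : R) (dt_range : 0 < dt <= 1) (N : nat) (N_def : N%:R = T / dt)
  (dWG X : nat -> Om -> H)
  (X_euler : euler_scheme e lam (V h) dt P N Q W F G x0 dWG X) :
  let mu := fun j => expect P (X j) in
  let Sigma := fun j => Cov P tens (X j) in
  [/\ (forall j, (j <= N)%N ->
         [/\ sq_integrable P (X j), V h (mu j)
           & tens_subspace tens (V h) (Sigma j)]),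
      (forall j, (j < N)%N -> sq_integrable P (dWG j)),
      mean_recursion e lam (V h) dt N F1 F2 mu,
      cov_recursion e lam (V h) dt P tens N F1 dWG Sigma
    & (forall m : nat -> H, (forall j, (j <= N)%N -> V h (m j)) ->
         m 0%N = mu 0%N -> mean_recursion e lam (V h) dt N F1 F2 m ->
         forall j, (j <= N)%N -> m j = mu j) /\
      (forall S : nat -> HH,
         (forall j, (j <= N)%N -> tens_subspace tens (V h) (S j)) ->
         S 0%N = Sigma 0%N -> cov_recursion e lam (V h) dt P tens N F1 dWG S ->
         forall j, (j <= N)%N -> S j = Sigma j)].
Proof.
move=> mu Sigma.
have VF := disc_fin_dim V_disc h_range.
have VS := fin_dim_is_subspace VF.
have V1 := disc_sub V_disc h_range.
have [n [b Vb]] := onb_exists VF.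
move: VF VS V1 Vb X_euler @mu @Sigma; move: (V h) => U _ US U1 Ub XE mu Sigma.
have dt0 : 0 < dt by case/andP: dt_range.
have TE : T = N%:R * dt by rewrite N_def divfK// gt_eqF.
have T0 : 0 <= T := ltW T_gt0.
pose t j := j%:R * dt : R.
have t0 j : 0 <= t j by rewrite mulr_ge0 ?ler0n// ltW.
have tT j : (j <= N)%N -> t j <= T.
  by move=> jN; rewrite TE /t ler_pM2r// ler_nat.
have tS j : t j <= t j.+1 by rewrite /t ler_pM2r// ler_nat.
have t0T j : (j <= N)%N -> 0 <= t j <= T by move=> jN; rewrite t0 tT.
pose Rh := Rop e lam U dt.
pose Fh j := F1op U dt F1 j.
pose Gh j := F2op U dt F2 j.
have RL : linear_on U Rh by exact: (Rop_linear US Ub U1).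
have RU f : U f -> U (Rh f) by exact: (Rop_mem US Ub U1).
have Rinj f : U f -> Rh f = 0 -> f = 0.
  exact: (Rop_inj US Ub U1 (ltW dt0)).
have FL j : (j < N)%N -> linear_on U (Fh j).
  by move=> jN; apply: (F1op_linear US Ub U1 F_drift); exact/t0T/ltnW.
have FU j f : (j < N)%N -> U f -> U (Fh j f).
  by move=> jN; apply: (F1op_mem US Ub U1 F_drift); exact/t0T/ltnW.
have GU j : (j < N)%N -> U (Gh j).
  by move=> jN; apply: (F2op_mem US Ub U1 F_drift); exact/t0T/ltnW.
have XU j w : (j <= N)%N -> U (X j w).
  by move=> jN; exact: (euler_rv XE jN).2.
have mX j phi : (j <= N)%N -> measurable_fun setT (fun w => dot (X j w) phi).
  by move=> jN; apply: rand_var_measurable_dot; exact: (euler_rv XE jN).1.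
have Xstep j : (j < N)%N ->
    {ae P, forall w, Fh j (X j w) + Gh j + dWG j w = Rh (X j.+1 w)}.
  move=> jN; apply: filterS (euler_step XE jN) => w Xw.
  by apply/esym/(euler_step_Rop US Ub U1 F_drift _ Xw); exact/t0T/ltnW.
have ito2 j : (j < N)%N -> Lfun2_in P U (dWG j).
  move=> jN; apply: (ito_Lfun2_in Q_psd W_wiener US Ub _ _ _ (euler_noise XE
    jN)).
  - exact: t0.
  - exact: tS.
  - exact: tT.
have ito0 j : (j < N)%N -> is_expect P (dWG j) 0.
  move=> jN; apply: (ito_expectation0 Q_psd W_wiener US Ub _ _ _ (euler_noise
    XE jN)).
  - exact: t0.
  - exact: tS.
  - exact: tT.
have itox j x phi : (j < N)%N -> x \in Lfun P 2 ->
    (forall u, 'E_P[fun w => (increment W (t j) (t j.+1) u w * x w)%R] = 0)%E ->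
    ('E_P[fun w => (dot (dWG j w) phi * x w)%R] = 0)%E.
  move=> jN; apply: (ito_uncorrelated Q_psd W_wiener US Ub _ _ _ (euler_noise
    XE jN)).
  - exact: t0.
  - exact: tS.
  - exact: tT.
have incr2 a c u : 0 <= a -> a <= c -> c <= T -> increment W a c u \in Lfun P 2.
  exact: (incr_Lfun2 Q_psd W_wiener).
have incr0 a c u : 0 <= a -> a <= c -> c <= T ->
  ('E_P[increment W a c u] = 0)%E.
  exact: (incr_expectation0 Q_psd W_wiener).
have Y2 j : (j < N)%N -> Lfun2_in P U (X j) ->
    Lfun2_in P U (fun w => Fh j (X j w) + Gh j + dWG j w).
  move=> jN X2; apply: (Lfun2_inD US _ (ito2 _ jN)).
  apply: (Lfun2_inD US _ (Lfun2_in_cst P (GU _ jN))).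
  exact: (Lfun2_in_linear US Ub (FL _ jN) (FU j ^~ jN) X2).
(* The two claims go through the induction together, as the mixed moments exist only for square
   integrable X_j. Arbitrary later intervals are allowed because the step applies the hypothesis on
   X_j to intervals beyond t_(j+1), and the covariance needs the interval starting at t_j. *)
have XP j : (j <= N)%N -> Lfun2_in P U (X j) /\
    forall a c u, t j <= a -> a <= c -> c <= T ->
      is_expect P (fun w => increment W a c u w *: X j w) 0.
  elim: j => [|j IH] jN.
    (* [X 0] equals P_h x_0 only almost everywhere; [Z] is P_h x_0 in coordinates, so the facts
       about components of [x0] apply to it. *)
    pose Z w := \sum_i dot (x0 w) (b i) *: b i.
    have Z2 : Lfun2_in P U Z.
      apply: (Lfun2_in_sum US) => i; apply: (Lfun2_in_scal US).
        exact: onb_mem Ub i.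
      exact: (initial_Lfun2 A_gen x0_gauss).
    have ZX : {ae P, forall w, Z w = X 0%N w}.
      apply: filterS (euler_init XE) => w ->.
      have xL : linear_on U (dot (x0 w) : H -> R^o).
        by move=> a x y _ _; rewrite dotDr dotZr.
      have [VP PE] := PprojP US Ub xL.
      rewrite [RHS](onb_expand Ub VP); apply: eq_bigr => i _.
      by rewrite PE//; exact: onb_mem Ub i.
    split.
      by apply: (ae_Lfun2_in Ub _ _ ZX Z2) => [w|phi]; [exact: XU|exact: mX].
    move=> a c u ta ac cT; have a0 := le_trans (t0 0%N) ta.
    apply: (@ae_is_expect _ _ _ _ _ (fun w => increment W a c u w *: Z w)).
    - move=> phi; under eq_fun do rewrite dotZl.
      apply: measurable_funM; last exact: mX.
      exact: Lfun_measurable (incr2 a c u a0 ac cT).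
    - by apply: filterS ZX => w ->.
    have E : is_expect P (fun w => \sum_i (dot (x0 w) (b i) * increment W a c
      u w) *: b i)
        (\sum_i 0 *: b i).
      apply: is_expect_sum => i; apply: is_expect_scal.
        by apply: Lfun2_mul; [exact: (initial_Lfun2 A_gen x0_gauss)|exact:
          incr2].
      apply: (adapted_incr_uncorrelated Ft_usual Q_psd W_wiener u (lexx 0) a0
        ac cT).
        exact: (initial_adapted Ft_usual A_gen x0_gauss).
      exact: (initial_Lfun2 A_gen x0_gauss).
    move: E; rewrite big1 => [|i _]; last by rewrite scale0r.
    apply: eq_is_expect => w; rewrite /Z scaler_sumr; apply: eq_bigr => i _.
    by rewrite scalerA mulrC.
  have [X2 X0] := IH (ltnW jN).
  have X2' : Lfun2_in P U (X j.+1).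
    apply: (Lfun2_in_dominated Ub _ _ _ (Y2 _ jN X2)) => [w|phi|].
    - exact: XU.
    - exact: mX.
    apply: filterS (Xstep _ jN) => w ->.
    by apply: (norm_le_Rop US Ub U1 (ltW dt0)); exact: XU.
  split=> // a c u ta ac cT.
  have a0 : 0 <= a := le_trans (t0 _) ta.
  have D2 := incr2 a c u a0 ac cT.
  have [m Um Xm] := Lfun2_in_expectM US Ub D2 X2'.
  (* Here [m] is the mixed moment of the increment and X_(j+1); it vanishes as soon as its image
     under R does. *)
  suff -> : 0 = m by [].
  apply/esym/Rinj => //.
  have E1 : is_expect P (fun w => increment W a c u w *: Rh (X j.+1 w)) (Rh m).
    apply: eq_is_expect (is_expect_linear US Ub RL _ Um Xm) => w /=.
      by rewrite (linear_onZ US RL)//; exact: XU.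
    by apply: (subspaceZ US); exact: XU.
  (* The first term vanishes by the induction hypothesis on [[a, c]], the second because increments
     are centred, the third because the noise belongs to [[t j, t j.+1]], which ends no later than
     [a]. *)
  have E2 : is_expect P (fun w => increment W a c u w *:
    (Fh j (X j w) + Gh j + dWG j w))
      (0 + 0 *: Gh j + 0).
    apply: (@eq_is_expect _ _ _ _ _ (fun w => increment W a c u w *:
      Fh j (X j w) +
      increment W a c u w *: Gh j + increment W a c u w *: dWG j w)).
      by move=> w; rewrite !scalerDr.
    apply: is_expectD; [apply: is_expectD|].
    - rewrite -(linear_on0 US (FL _ jN)).
      have := is_expect_linear US Ub (FL _ jN) _ US.1 (X0 a c u (le_trans (tS
        j) ta) ac cT).
      move=> /(_ (fun w => subspaceZ US _ (XU _ w (ltnW jN)))).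
      apply: eq_is_expect => w /=.
      by rewrite (linear_onZ US (FL _ jN))//; apply: XU; exact: ltnW.
    - by apply: is_expect_scal; [exact: Lfun2_Lfun1|exact: incr0].
    - have [m' Um' Em'] := Lfun2_in_expectM US Ub D2 (ito2 _ jN).
      suff <- : m' = 0 by [].
      apply: dot_inj => phi; rewrite dot0l; apply: EFin_inj.
      rewrite -(Em' phi).2 -[RHS](itox j _ phi jN D2).
        by congr expectation; apply/funext => w; rewrite dotZl mulrC.
      move=> v; apply: (incr_uncorrelated Ft_usual Q_psd W_wiener) => //.
  have := ae_is_expect_eq E2 E1.
  rewrite scale0r !addr0 => <-//.
  by apply: filterS (Xstep _ jN) => w ->.
have X2 j : (j <= N)%N -> Lfun2_in P U (X j) by move=> /XP[].
have muP j : (j <= N)%N -> U (mu j) /\ is_expect P (X j) (mu j).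
  move=> jN; have [m Um Xm] := Lfun2_in_expect US Ub (X2 _ jN).
  by rewrite /mu (is_expect_expect Xm).
pose Xc j w := X j w - mu j.
have Xc2 j : (j <= N)%N -> Lfun2_in P U (Xc j).
  move=> jN; have UN : U (- mu j).
    by rewrite -scaleN1r; apply: (subspaceZ US); exact: (muP _ jN).1.
  exact: (Lfun2_inD US (X2 _ jN) (Lfun2_in_cst P UN)).
have SigmaP j : (j <= N)%N -> tens_subspace tens U (Sigma j) /\
    is_expect P (fun w => tens (Xc j w) (Xc j w)) (Sigma j).
  move=> jN; have [S US' SP] := Lfun2_in_tens US Ub tens_HH (Xc2 _ jN).
  by rewrite /Sigma /Cov /second_moment (is_expect_expect SP).
have mean_rec j : (j < N)%N -> Rh (mu j.+1) = Fh j (mu j) + Gh j.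
  move=> jN; have [Um Em] := muP _ (ltnW jN); have [Um' Em'] := muP _ jN.
  have E1 := is_expect_linear US Ub RL (fun w => XU _ w jN) Um' Em'.
  have E2 := is_expectD (is_expectD
    (is_expect_linear US Ub (FL _ jN) (fun w => XU _ w (ltnW jN)) Um Em)
    (is_expect_cst P (Gh j))) (ito0 _ jN).
  have := ae_is_expect_eq E2 E1; rewrite addr0 => <-//.
  exact: Xstep.
have cov_rec j : (j < N)%N -> tens_op tens U Rh Rh (Sigma j.+1) =
    tens_op tens U (Fh j) (Fh j) (Sigma j) + second_moment P tens (dWG j).
  move=> jN; have jN' := ltnW jN.
  have [USj SjP] := SigmaP _ jN'; have [USj' SjP'] := SigmaP _ jN.
  have [S2 _ S2P] := Lfun2_in_tens US Ub tens_HH (ito2 _ jN).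
  rewrite /second_moment (is_expect_expect S2P).
  have E1 := is_expect_tens_op US Ub tens_HH RL (Xc2 _ jN).1 USj' SjP'.
  have FX2 : Lfun2_in P U (Fh j \o Xc j).
    exact: (Lfun2_in_linear US Ub (FL _ jN) (FU j ^~ jN) (Xc2 _ jN')).
  have FXW i k : ('E_P[fun w =>
      (dot (dWG j w) (b k) * dot ((Fh j \o Xc j) w) (b i))%R] = 0)%E.
    apply: itox => //; first exact: FX2.2.
    move=> u; have D2 := incr2 (t j) (t j.+1) u (t0 _) (tS _) (tT _ jN).
    have D0 := incr0 (t j) (t j.+1) u (t0 _) (tS _) (tT _ jN).
    (* Centring preserves the orthogonality to the increment, which has mean zero. *)
    have E : is_expect P (fun w => increment W (t j) (t j.+1) u w *: Xc j w)
        (0 + 0 *: (- mu j)).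
      have := is_expectD ((XP _ jN').2 _ _ u (lexx _) (tS _) (tT _ jN))
        (is_expect_scal (- mu j) (Lfun2_Lfun1 D2) D0).
      by apply: eq_is_expect => w; rewrite -scalerDr.
    rewrite scale0r addr0 in E.
    have := is_expect_linear US Ub (FL _ jN)
      (fun w => subspaceZ US _ ((Xc2 _ jN').1 w)) US.1 E.
    rewrite (linear_on0 US (FL _ jN)) => /(_ (b i))[_].
    rewrite dot0l => hE; apply: etrans hE.
    congr expectation; apply/funext => w /=.
    by rewrite (linear_onZ US (FL _ jN)) ?dotZl//; exact: (Xc2 _ jN').1.
  have FXW' i k : ('E_P[fun w =>
      (dot ((Fh j \o Xc j) w) (b i) * dot (dWG j w) (b k))%R] = 0)%E.
    apply: etrans (FXW i k).
    by congr expectation; apply/funext => w; rewrite mulrC.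
  (* The four terms of the tensor square of F^1 (X_j - mu_j) + dWG_j, in the order in which
     bilinearity produces them; the two mixed ones vanish. *)
  have E2 := is_expectD (is_expectD (is_expectD
    (is_expect_tens_op US Ub tens_HH (FL _ jN) (Xc2 _ jN').1 USj SjP)
    (is_expect_tens0 Ub tens_HH FX2 (ito2 _ jN) FXW'))
    (is_expect_tens0 Ub tens_HH (ito2 _ jN) FX2 (fun k i => FXW i k))) S2P.
  rewrite -(ae_is_expect_eq E2 E1) ?addr0//.
  apply: filterS (Xstep _ jN) => w /= Xw.
  (* Subtracting the mean recursion from the scheme cancels the deterministic term [Gh j]. *)
  have -> : Rh (Xc j.+1 w) = Fh j (Xc j w) + dWG j w.
    rewrite /Xc (linear_onB RL) ?(linear_onB (FL _ jN)).
    + rewrite -Xw mean_rec// [LHS]addrAC; congr (_ + _).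
      by rewrite opprD addrACA subrr addr0.
    + exact: XU.
    + exact: (muP _ jN').1.
    + exact: XU.
    + exact: (muP _ jN).1.
  move: (Fh j (Xc j w)) (dWG j w) => f g.
  by rewrite !(tensDl tens_HH) !(tensDr tens_HH) !addrA.
split.
- move=> j jN; split.
  + exact: (Lfun2_in_sq_integrable Ub (euler_rv XE jN).1 (X2 _ jN)).
  + exact: (muP _ jN).1.
  + exact: (SigmaP _ jN).1.
- move=> j jN; apply: (Lfun2_in_sq_integrable Ub _ (ito2 _ jN)).
  by have [] := euler_noise XE jN.
- exact: mean_rec.
- exact: cov_rec.
split.
- move=> m mU m0 mrec; elim=> [//|j IH] jN.
  have Uj := mU _ jN; have Uj' := (muP _ jN).1.
  (* R is injective on [U], so it suffices to compare the images under R, which both recursions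
     prescribe from equal data. *)
  apply/eqP; rewrite -subr_eq0; apply/eqP/Rinj; first exact: (subspaceB US).
  rewrite (linear_onB RL)//; apply/eqP; rewrite subr_eq0; apply/eqP.
  by rewrite mean_rec// -(IH (ltnW jN)); exact: mrec.
- move=> S SU S0 Srec; elim=> [//|j IH] jN.
  have Uj := SU _ jN; have Uj' := (SigmaP _ jN).1.
  have UB : tens_subspace tens U (S j.+1 - Sigma j.+1).
    by rewrite addrC -scaleN1r; exact: tens_subspace_lin.
  apply/eqP; rewrite -subr_eq0; apply/eqP.
  (* The same argument one level up, with R (x) R injective on the tensor square of [U]. *)
  apply: (tens_coord_inj tens_HH US Ub RL RU Rinj UB).
  rewrite addrC -scaleN1r tens_coord_linear.
  rewrite -!(tens_opE tens_HH US Ub RL RL)// cov_rec// -(IH (ltnW jN)).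
  by rewrite (Srec _ jN) scaleN1r addNr.
Qed.
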